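(* Let $1\le k<n$, let $R\in SYT_k$ be a standard Young tableau of hook shape, and let $Q\in SYT_k$ be another tableau having the same shape as $R$. Let $S,T\in SYT_n^{R}$ and suppose that $S\leq_{weak}T$ is a covering relation in $SYT_n^{R}$. Then $\mathcal{V}_{[R,Q]}(S)\leq_{weak}\mathcal{V}_{[R,Q]}(T)$ is also a covering relation in $SYT_n^{Q}$.
   Context: $SYT_n$ is the set of standard Young tableaux with $n$ cells (English convention, rows and columns increasing). A hook shape is a partition of the form $(a,1,\ldots,1)$. For a permutation $w\in \mathfrak{S}_n$ (written in one-line notation $w_1\ldots w_n$), $I(w)\in SYT_n$ is its Robinson–Schensted (row) insertion tableau, and for $T\in SYT_n$, $\mathcal{Y}_T=\{w\in \mathfrak{S}_n: I(w)=T\}$ is its Knuth class. The right weak Bruhat order on $\mathfrak{S}_n$ is the transitive (and reflexive) closure of: $u\leq_{weak} w$ if $w=u\cdot s_i$ with $\mathrm{length}(w)=\mathrm{length}(u)+1$, where $s_i=(i,i+1)$; that is, $w$ is obtained from $u=u_1\ldots u_n$ by swapping the letters $u_i<u_{i+1}$ in adjacent positions. The weak order $\leq_{weak}$ on $SYT_n$ is the partial order obtained as the transitive closure of the relation: $S\leq_{weak}T$ if there exist $\sigma\in\mathcal{Y}_S$, $\tau\in\mathcal{Y}_T$ with $\sigma\leq_{weak}\tau$. For $1\le k<n$ and $R\in SYT_k$, $SYT_n^{R}$ is the set of $T\in SYT_n$ whose subtableau $T_{[1,k]}$ consisting of the entries $1,\ldots,k$ equals $R$, ordered by $\leq_{weak}$.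 For $R,Q\in SYT_k$ of the same shape, the inner tableau translation map $\mathcal{V}_{[R,Q]}:SYT_n^{R}\to SYT_n^{Q}$ sends $T$ to the tableau obtained by replacing the inner tableau $R$ of $T$ with $Q$ (leaving the other entries in place). A covering relation $S\leq_{weak} T$ in a set of tableaux means that $S\leq_{weak} T$, $S\neq T$, and there is no tableau $P\ne S,T$ in that set with $S\leq_{weak}P\leq_{weak}T$. *)

(* Defs.v *)
From Stdlib Require Import Relation_Operators.
From mathcomp Require Import all_boot all_fingroup.

Set Implicit Arguments.
Unset Strict Implicit.
Unset Printing Implicit Defensive.

(* A tableau is the list of its rows, top to bottom (English convention). *)
Definition tableau : Type := seq (seq nat).

(* The row [lower] may sit directly below the row [upper]. *)
Definition col_increasing (upper lower : seq nat) : bool :=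
  (size lower <= size upper) &&
  all (fun j => nth 0 upper j < nth 0 lower j) (iota 0 (size lower)).

(* Rows are required to be nonempty so that each standard Young tableau has
   exactly one representation; [shape T] is then its partition. *)
Definition SYT (n : nat) : pred tableau := fun T =>
  [&& all (fun r => r != [::]) T,
      all (sorted ltn) T,
      sorted col_increasing T
    & perm_eq (flatten T) (iota 1 n)].

Definition is_hook (lam : seq nat) : Prop :=
  exists a m : nat, 0 < a /\ lam = a :: nseq m 1.

(* The result is the new row together with the bumped entry, if any. *)
Fixpoint row_insert (x : nat) (r : seq nat) : seq nat * option nat :=
  if r is y :: r' then
    if x < y then (x :: r', Some y)
    else let: (r1, bumped) := row_insert x r' in (y :: r1, bumped)
  else ([:: x], None).

Fixpoint tableau_insert (T : tableau) (x : nat) : tableau :=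
  if T is r :: T' then
    let: (r1, bumped) := row_insert x r in
    if bumped is Some y then r1 :: tableau_insert T' y else r1 :: T'
  else [:: [:: x]].

(* ['S_n] permutes {0, ..., n-1}; the letters are shifted to {1, ..., n}. *)
Definition one_line (n : nat) (w : 'S_n) : seq nat :=
  [seq (w i : nat).+1 | i <- enum 'I_n].

Definition insertion_tableau (n : nat) (w : 'S_n) : tableau :=
  foldl tableau_insert [::] (one_line w).

Definition Knuth_class (n : nat) (T : tableau) : {set 'S_n} :=
  [set w | insertion_tableau w == T].

(* Products in ['S_n] are composed left to right, so [tperm i j * u] is
   u \o (i j): the word of u with the letters in positions i and j swapped,
   i.e. the product written u s_i when the right factor is applied first. *)
Definition weak_perm_step (n : nat) : rel 'S_n := fun u w =>
  [exists i : 'I_n, exists j : 'I_n,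
    [&& j == i.+1 :> nat, u i < u j & w == (tperm i j * u)%g]].

(* [connect] is the reflexive transitive closure. *)
Definition weak_perm (n : nat) : rel 'S_n := connect (@weak_perm_step n).

Definition weak_tableau_step (n : nat) (S T : tableau) : Prop :=
  [/\ S \in SYT n, T \in SYT n &
      exists s t : 'S_n,
        [/\ s \in Knuth_class n S, t \in Knuth_class n T & weak_perm s t]].

Definition weak_le (n : nat) : tableau -> tableau -> Prop :=
  clos_trans tableau (weak_tableau_step n).

Definition inner_tableau (k : nat) (T : tableau) : tableau :=
  [seq r <- [seq [seq x <- row | x <= k] | row <- T] | r != [::]].

Definition SYT_inner (n k : nat) (R : tableau) : pred tableau := fun T =>
  (T \in SYT n) && (inner_tableau k T == R).

(* When R and Q have the same shape, Q occupies exactly the cells of R. *)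
Definition inner_translation (R Q T : tableau) : tableau :=
  mkseq (fun i => nth [::] Q i ++ drop (size (nth [::] R i)) (nth [::] T i))
        (size T).

Definition covering (A : pred tableau) (le : tableau -> tableau -> Prop)
    (S T : tableau) : Prop :=
  [/\ S \in A, T \in A, le S T, S <> T &
      ~ exists P : tableau,
          [/\ P \in A, P <> S, P <> T, le S P & le P T]].

(* Main.v *)
Require Import Defs.
From mathcomp Require Import all_boot all_fingroup.
From Stdlib Require Import Relation_Operators Operators_Properties.
From mathcomp Require Import zify.

(** The map [inner_translation R Q] is an isomorphism of posets from SYT_n^R
    onto SYT_n^Q, with inverse [inner_translation Q R], so it preserves covering
    relations. By symmetry it is enough to show that it is monotone
    ([inner_translation_le]).

    The order is studied on words. A relation S <= T holds exactly when a word
    with insertion tableau S can be turned into one with insertion tableau T by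
    ascent swaps (xy becomes yx, where x < y) and Knuth moves in either
    direction ([weak_le_words], [words_weak_le]). Behind this is Knuth's theorem
    that two words have the same insertion tableau iff Knuth moves connect them
    ([plactic_tab], [tab_word_plactic]).

    Translation is lifted to words as follows ([translated]): u and u' have the
    same letters greater than k in the same positions, and their subwords of
    letters at most k insert to R and to Q and have descents in the same
    positions. For a hook, the descents of a word determine the shape of the
    insertion tableau of each of its prefixes ([shape_hook_prefix]), and during
    an insertion the fate of the letters greater than k depends on these shapes
    only ([tab_word_same_outer]). Hence the insertion tableau of u' is the
    translation of that of u ([translated_inner]).

    A chain of words from S to T never leaves SYT_n^R ([hook_squeeze]). So it
    remains to translate one ascent swap ([translated_ascent]). If the larger
    letter exceeds k, the swap is copied. Otherwise both subwords of small
    letters, before and after the swap, insert to R, hence have equally many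
    descents; this forces a neighbour b of the swapped letters a < c, in the
    subword, with a < b < c. The swap is thus a Knuth move of the subword, and on
    the side of Q it corresponds to a Knuth move of the three letters in the same
    positions. Either that move swaps the same two positions, and it is again an
    ascent swap, or it swaps the other two, which in the full word are separated
    by a block B of letters greater than k: bcBa becomes baBc, or cBab becomes
    aBcb, where a < b < c. These pairs of words are in general not comparable in
    the weak order of permutations, but their Knuth classes are
    ([word_le_far_descent], [word_le_far_ascent]). *)

Set Implicit Arguments.
Unset Strict Implicit.
Unset Printing Implicit Defensive.

(** * Row insertion and Knuth moves *)

Definition tab_word : seq nat -> tableau := foldl tableau_insert [::].

Definition reading_word (T : tableau) : seq nat := flatten (rev T).

(** The second component collects the bumped letters: it is the word that the
    rows below receive, so a tableau can be treated one row at a time. *)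
Fixpoint row_word (r w : seq nat) : seq nat * seq nat :=
  if w is x :: w' then
    let: (r1, o) := row_insert x r in
    let: (r2, out) := row_word r1 w' in (r2, seq_of_opt o ++ out)
  else (r, [::]).

Variant row_insert_spec x r : seq nat * option nat -> Prop :=
| RowEnd of all (fun e => e <= x) r : row_insert_spec x r (rcons r x, None)
| RowBump r1 y r2 of r = r1 ++ y :: r2 & all (fun e => e <= x) r1 & x < y :
    row_insert_spec x r (r1 ++ x :: r2, Some y).

Lemma row_insertP x r : row_insert_spec x r (row_insert x r).
Proof.
elim: r => [|h t IH] /=; first exact: RowEnd.
case: ltnP => [lt_xh | le_hx]; first exact: (@RowBump _ _ [::]).
case: IH => [le_t | r1 y r2 -> le_r1 lt_xy].
  by apply: RowEnd; rewrite /= le_hx.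
by apply: (@RowBump _ _ (h :: r1)) => //=; rewrite le_hx.
Qed.

Lemma row_insert_perm x r :
  perm_eq ((row_insert x r).1 ++ seq_of_opt (row_insert x r).2) (x :: r).
Proof.
case: row_insertP => [_ | r1 y r2 -> _ _] /=; apply/seq.permP => p;
  rewrite -?cats1 ?cats0 /= ?count_cat /= ?count_cat /=; lia.
Qed.

Lemma row_insert_sorted x r :
  pairwise leq r -> pairwise leq (row_insert x r).1.
Proof.
case: row_insertP => [le_r s_r | r1 y r2 -> le_r1 lt_xy] /=.
  by rewrite pairwise_rcons le_r.
rewrite !pairwise_cat !allrel_consr /= => /and3P[/andP[_ ->] -> /andP[le_y ->]].
rewrite le_r1 !andbT /=; apply/allP => e /(allP le_y); lia.
Qed.

Lemma foldl_tableau_insert_cons r T w :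
  foldl tableau_insert (r :: T) w =
  (row_word r w).1 :: foldl tableau_insert T (row_word r w).2.
Proof.
elim: w r T => //= x w IH r T.
case: (row_insert x r) => r1 [y|] /=; rewrite IH;
  by case: (row_word r1 w).
Qed.

Lemma tableau_insert_sorted T x :
  all (pairwise leq) T -> all (pairwise leq) (tableau_insert T x).
Proof.
elim: T x => [|r T IH] x //= /andP[s_r s_T].
have := row_insert_sorted x s_r.
by case: row_insert => r1 [y|] /= ->; rewrite ?IH.
Qed.

Lemma foldl_tableau_insert_sorted T w :
  all (pairwise leq) T -> all (pairwise leq) (foldl tableau_insert T w).
Proof. by elim: w T => //= x w IH T s_T; apply/IH/tableau_insert_sorted. Qed.

Lemma tableau_insert_perm T x :
  perm_eq (flatten (tableau_insert T x)) (x :: flatten T).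
Proof.
elim: T x => [|r T IH] x //=.
have := row_insert_perm x r.
case: row_insert => r1 [y|] /= /seq.permP pr; apply/seq.permP => p; move: (pr p);
  rewrite /= !count_cat /= ?(seq.permP (IH y)) /=; lia.
Qed.

Lemma tab_word_perm w : perm_eq (flatten (tab_word w)) w.
Proof.
elim/last_ind: w => // w x; rewrite /tab_word foldl_rcons => IH.
rewrite (perm_trans (tableau_insert_perm _ _)) // perm_sym perm_rcons.
by rewrite perm_cons perm_sym.
Qed.

(** The plactic relations in their form for words with repeated letters: it is
    the form that passes to the bumped letters when a row has equal entries. *)
Variant knuth3 : seq nat -> seq nat -> Prop :=
| Knuth_bac x y z of x < y & y <= z : knuth3 [:: y; x; z] [:: y; z; x]
| Knuth_acb x y z of x <= y & y < z : knuth3 [:: x; z; y] [:: z; x; y].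

Definition knuth_step (u w : seq nat) : Prop :=
  exists A p q B, [/\ knuth3 p q, u = A ++ p ++ B & w = A ++ q ++ B].

Definition plactic : seq nat -> seq nat -> Prop :=
  clos_refl_sym_trans _ knuth_step.

Lemma row_word_cons h t w :
  all (leq h) w -> row_word (h :: t) w = (h :: (row_word t w).1, (row_word t w).2).
Proof.
elim: w t => //= x w IH t /andP[le_hx le_hw].
rewrite ltnNge le_hx /=; case: (row_insert x t) => t1 o.
by rewrite IH //; case: (row_word t1 w).
Qed.

Lemma row_insert_nondecreasing t b c : b <= c -> pairwise leq t ->
  forall z, (row_insert c (row_insert b t).1).2 = Some z ->
  exists y, [/\ (row_insert b t).2 = Some y, b < y & y <= z].
Proof.
move=> le_bc; case: (row_insertP b t) => [le_t _ | r1 y r2 -> le_r1 lt_by /=].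
  move=> z /=; case: row_insertP => //= s1 v s2 e _ lt_cv [ez]; exfalso.
  have : v \in rcons t b by rewrite e mem_cat inE eqxx orbT.
  by rewrite mem_rcons inE => /orP[/eqP|/(allP le_t)]; lia.
rewrite pairwise_cat /= => /and3P[_ _ /andP[le_y _]] z.
case: row_insertP => //= s1 v s2 e _ lt_cv [ez]; subst v; exists y.
have zin : z \in r1 ++ b :: r2 by rewrite e mem_cat inE eqxx orbT.
move: zin; rewrite !mem_cat !inE => /or3P[/(allP le_r1)|/eqP|z_r2]; try lia.
by rewrite (allP le_y).
Qed.

Lemma row_insert_decreasing t b c : b < c ->
  exists y, [/\ (row_insert b (row_insert c t).1).2 = Some y, b < y, y <= c
    & y \in c :: t].
Proof.
move=> lt_bc; case: (row_insertP c t) => [le_t | r1 v r2 -> le_r1 lt_cv] /=.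
  case: row_insertP => [le_b | s1 y s2 e _ lt_by].
    by move: le_b; rewrite all_rcons => /andP[]; lia.
  have : y \in rcons t c by rewrite e mem_cat inE eqxx orbT.
  rewrite mem_rcons => yin; exists y; split=> //.
  by move: yin; rewrite inE => /orP[/eqP->|/(allP le_t)].
case: row_insertP => [le_b | s1 y s2 e le_s1 lt_by].
  by move: le_b; rewrite all_cat /= => /and3P[_]; lia.
exists y; split=> //.
  have [le_sz | lt_sz] := leqP (size s1) (size r1).
    have : nth 0 (r1 ++ c :: r2) (size s1) = y by rewrite e nth_cat ltnn subnn.
    rewrite nth_cat; case: ltnP => [lt_s <-|]; last first.
      by move=> le_rs; rewrite (_ : _ - _ = 0) /=; [lia|lia].
    by apply: (allP le_r1); rewrite mem_nth.
  have : c \in s1.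
    have <- : nth 0 (r1 ++ c :: r2) (size r1) = c by rewrite nth_cat ltnn subnn.
    by rewrite e nth_cat lt_sz mem_nth.
  by move/(allP le_s1); lia.
have : y \in r1 ++ c :: r2 by rewrite e mem_cat inE eqxx orbT.
by rewrite !(inE, mem_cat) => /or3P[->|->|->]; rewrite ?orbT.
Qed.

Ltac decide_comparisons :=
  repeat (simpl; match goal with |- context[if leq ?a ?b then _ else _] =>
    first [rewrite (_ : leq a b = true); last by lia
          |rewrite (_ : leq a b = false); last by lia] end); simpl.

(** Two words related by a Knuth move leave the same row behind, and the words
    that they bump are equal or related by a Knuth move, possibly of the other
    kind or in the other direction. This is what lets the argument go down the
    rows of a tableau. *)
Lemma row_word_knuth3 r p q : pairwise leq r -> knuth3 p q ->
  (row_word r p).1 = (row_word r q).1 /\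
  [\/ (row_word r p).2 = (row_word r q).2,
      knuth3 (row_word r p).2 (row_word r q).2
    | knuth3 (row_word r q).2 (row_word r p).2].
Proof.
elim: r p q => [|h t IH] p q.
  by move=> _ [x y z lt_xy le_yz | x y z le_xy lt_yz]; decide_comparisons;
    split=> //; constructor 1.
move=> s_ht kpq; have [le_h|] := boolP (all (leq h) p).
  have le_hq : all (leq h) q.
    by case: kpq le_h => x y z _ _ /= /and4P[-> -> -> _].
  rewrite !row_word_cons //=; case/andP: s_ht => _ s_t.
  by have [-> ] := IH _ _ s_t kpq.
(* Some letter, hence the smallest one, is less than the head [h]; the cases
   differ in which of the other two letters are. *)
case/andP: s_ht => le_ht s_t {IH}.
case: kpq => [x y z lt_xy le_yz | x y z le_xy lt_yz] not_h.
  have lt_xh : x < h by move: not_h => /=; lia.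
  have [le_hy | lt_yh] := leqP h y; last first.
    rewrite /= lt_yh /= lt_xy (ltnNge z y) le_yz /= (ltnNge z x).
    rewrite (ltnW (leq_trans lt_xy le_yz)) /=.
    case: row_insertP => [_ | r1 v r2 tE _ lt_zv] /=; rewrite ?lt_xy /=.
      by split=> //; constructor 1.
    split=> //; constructor 2; apply: Knuth_bac => //.
    by apply: (allP le_ht); rewrite tE mem_cat inE eqxx orbT.
  rewrite /= (ltnNge y) le_hy /=.
  move: (row_insert_nondecreasing le_yz s_t).
  case ey: (row_insert y t) => [t1 o1] /=.
  rewrite lt_xh /= !(ltnNge z) (ltnW (leq_trans lt_xy le_yz)).
  rewrite (leq_trans le_hy le_yz) /=.
  case ez: (row_insert z t1) => [t2 o2] /= o2P; rewrite lt_xh /=.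
  case: o2 ez o2P => [v|] ez o2P; last by split=> //; constructor 1; case: o1 {ey o2P}.
  have [y' [-> lt_y le_v]] := o2P _ erefl.
  by split=> //; constructor 2; apply: Knuth_bac; lia.
have lt_xh : x < h by move: not_h => /=; lia.
have [le_hz | lt_zh] := leqP h z.
  have := row_insert_decreasing t lt_yz.
  rewrite /= lt_xh /= (ltnNge z) (leq_trans le_xy (ltnW lt_yz)) /=.
  rewrite (ltnNge z) le_hz /=.
  case: (row_insertP z t) => [le_t | r1 v r2 tE le_r1 lt_zv] /=;
    rewrite (ltnNge y) le_xy /= lt_xh /= (ltnNge y) le_xy /=;
    case: (row_insert y _) => t2 [y'|] /= [y0 [//] [<-]] lt_yy le_yz yin;
    split=> //; first by constructor 1.
  constructor 2; apply: Knuth_acb; try lia.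
  by move: yin; rewrite inE => /orP[/eqP->|/(allP le_ht)].
case: t le_ht s_t => [|h' t] /= => [_ _ | /andP[le_hh _] _]; decide_comparisons.
  by split=> //; constructor 1.
by split=> //; constructor 3; apply: Knuth_bac.
Qed.

Lemma knuth3_insert T p q : all (pairwise leq) T -> knuth3 p q ->
  foldl tableau_insert T p = foldl tableau_insert T q.
Proof.
elim: T p q => [|r T IH] p q.
  have e w : w <> [::] ->
      foldl tableau_insert [::] w = foldl tableau_insert [:: [::]] w.
    by case: w.
  move=> _ kpq; rewrite !e; try by case: kpq.
  rewrite !foldl_tableau_insert_cons.
  have [-> out] := @row_word_knuth3 [::] _ _ isT kpq.
  by congr (_ :: _); case: kpq {out} => x y z h1 h2; decide_comparisons.
case/andP=> s_r s_T kpq; rewrite !foldl_tableau_insert_cons.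
have [-> [->|k2|k2]] := row_word_knuth3 s_r kpq => //; first by rewrite (IH _ _ s_T k2).
by rewrite -(IH _ _ s_T k2).
Qed.

Lemma knuth_step_tab u w : knuth_step u w -> tab_word u = tab_word w.
Proof.
case=> A [p [q [B [kpq -> ->]]]]; rewrite /tab_word !foldl_cat; congr foldl.
by apply: knuth3_insert kpq; apply: foldl_tableau_insert_sorted.
Qed.

Lemma plactic_tab u w : plactic u w -> tab_word u = tab_word w.
Proof. by elim=> {u w} [u w /knuth_step_tab|//|//|u v w _ -> _ ->]. Qed.

(** * The plactic order on words *)

Lemma plactic_refl u : plactic u u. Proof. exact: rst_refl. Qed.
Lemma plactic_sym u w : plactic u w -> plactic w u. Proof. exact: rst_sym. Qed.
Lemma plactic_trans v u w : plactic u v -> plactic v w -> plactic u w.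
Proof. exact: rst_trans. Qed.

Lemma plactic_knuth3 p q : knuth3 p q -> plactic p q.
Proof.
by move=> kpq; apply: rst_step; exists [::], p, q, [::]; rewrite /= !cats0.
Qed.

Lemma plactic_cat A B u w : plactic u w -> plactic (A ++ u ++ B) (A ++ w ++ B).
Proof.
elim=> {u w} [u w [A' [p [q [B' [kpq -> ->]]]]]|u|u w _|u v w _ uv _].
- by apply: rst_step; exists (A ++ A'), p, q, (B' ++ B); rewrite -!catA.
- exact: plactic_refl.
- exact: plactic_sym.
- exact: plactic_trans.
Qed.

Lemma plactic_catl A u w : plactic u w -> plactic (A ++ u) (A ++ w).
Proof. by move/(plactic_cat A [::]); rewrite !cats0. Qed.

Lemma plactic_catr B u w : plactic u w -> plactic (u ++ B) (w ++ B).
Proof. exact: (plactic_cat [::] B). Qed.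

Lemma plactic_cons a u w : plactic u w -> plactic (a :: u) (a :: w).
Proof. exact: (@plactic_catl [:: a]). Qed.

Lemma plactic_bac x y z B : x < y -> y <= z ->
  plactic [:: y, x, z & B] [:: y, z, x & B].
Proof.
move=> lt_xy le_yz.
by apply: (@plactic_catr B [:: y; x; z] [:: y; z; x]); apply/plactic_knuth3/Knuth_bac.
Qed.

Lemma plactic_acb x y z B : x <= y -> y < z ->
  plactic [:: x, z, y & B] [:: z, x, y & B].
Proof.
move=> le_xy lt_yz.
by apply: (@plactic_catr B [:: x; z; y] [:: z; x; y]); apply/plactic_knuth3/Knuth_acb.
Qed.

Lemma small_moves_left x y s : x < y -> path leq y s ->
  plactic (y :: s ++ [:: x]) [:: y, x & s].
Proof.
elim: s y => [|z s IH] y lt_xy /=; first by move=> _; apply: plactic_refl.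
case/andP=> le_yz p_s; have lt_xz := leq_trans lt_xy le_yz.
apply: plactic_trans (plactic_cons y (IH z lt_xz p_s)) _.
exact/plactic_sym/plactic_bac.
Qed.

Lemma large_moves_left x y s : x < y -> pairwise leq (rcons s x) ->
  plactic (s ++ [:: y; x]) (y :: s ++ [:: x]).
Proof.
elim: s => [|z s IH] lt_xy /=; first by move=> _; apply: plactic_refl.
case/andP=> le_z s_s; apply: plactic_trans (plactic_cons z (IH lt_xy s_s)) _.
have le_zx : z <= x by move: le_z; rewrite all_rcons => /andP[].
case: s s_s le_z {IH} => [|e s] /=; first by move=> _ _; apply: plactic_acb.
case/andP; rewrite all_rcons => /andP[le_ex _] _ /andP[le_ze _].
by apply: plactic_acb => //; lia.
Qed.

Lemma small_moves_right b d D : sorted gtn (rcons D d) -> all (ltn b) (rcons D d) ->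
  plactic (b :: rcons D d) (D ++ [:: b; d]).
Proof.
elim: D => [|e D IH] /=; first by move=> _ _; apply: plactic_refl.
move=> p_D /andP[lt_be lt_bD]; have s_D := path_sorted p_D.
apply: plactic_trans (plactic_cons e (IH s_D lt_bD)).
case: D p_D {IH s_D} lt_bD => [|f D] /= /andP[lt_fe _] /andP[lt_bf _];
  by apply: plactic_acb => //; apply: ltnW.
Qed.

(** The new letter [x] moves left through the larger entries up to the entry [y]
    that it bumps; then [y] moves left through the smaller entries and leaves the
    row. *)
Lemma row_insert_plactic r x : pairwise leq r ->
  plactic (r ++ [:: x])
    (seq_of_opt (row_insert x r).2 ++ (row_insert x r).1).
Proof.
case: row_insertP => [_ _ | r1 y r2 -> le_r1 lt_xy] /=.
  by rewrite cats1; apply: plactic_refl.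
rewrite pairwise_cat -(sorted_pairwise leq_trans (y :: r2)).
case/and3P=> _ s_r1 p_r2.
rewrite -catA -cat1s; apply: plactic_trans (plactic_catl r1 (small_moves_left lt_xy p_r2)) _.
have s_r1x : pairwise leq (rcons r1 x) by rewrite pairwise_rcons le_r1.
have := plactic_catr r2 (large_moves_left lt_xy s_r1x).
by rewrite -!catA /= -catA.
Qed.

Lemma reading_word_cons r T : reading_word (r :: T) = reading_word T ++ r.
Proof. by rewrite /reading_word rev_cons flatten_rcons. Qed.

Lemma tableau_insert_plactic T x : all (pairwise leq) T ->
  plactic (reading_word T ++ [:: x]) (reading_word (tableau_insert T x)).
Proof.
elim: T x => [|r T IH] x; first by move=> _; apply: plactic_refl.
case/andP=> s_r s_T; rewrite reading_word_cons -catA.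
have := plactic_catl (reading_word T) (row_insert_plactic x s_r).
rewrite /=; case: (row_insert x r) => r1 [y|] /=; rewrite reading_word_cons //.
move/plactic_trans; apply; rewrite -cat1s catA.
exact/plactic_catr/IH.
Qed.

Lemma plactic_reading_word w : plactic w (reading_word (tab_word w)).
Proof.
elim/last_ind: w => [|w x IH]; first exact: plactic_refl.
rewrite -cats1 /tab_word foldl_cat /=.
apply: plactic_trans (plactic_catr [:: x] IH) _.
exact/tableau_insert_plactic/foldl_tableau_insert_sorted.
Qed.

Lemma tab_word_plactic u w : tab_word u = tab_word w -> plactic u w.
Proof.
move=> e; apply: plactic_trans (plactic_reading_word u) _.
by rewrite e; apply/plactic_sym/plactic_reading_word.
Qed.

Definition ascent_swap (u w : seq nat) : Prop :=
  exists A x y B, [/\ x < y, u = A ++ [:: x; y] ++ B & w = A ++ [:: y; x] ++ B].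

(** Only Knuth moves are allowed to remove an inversion. Together with the ascent
    swaps they generate Knuth equivalence as well, because in the direction fixed
    by [knuth3] both Knuth moves are ascent swaps. *)
Definition word_step u w := ascent_swap u w \/ knuth_step w u.

Definition word_le : seq nat -> seq nat -> Prop := clos_refl_trans _ word_step.

Lemma word_le_refl u : word_le u u. Proof. exact: rt_refl. Qed.
Lemma word_le_trans v u w : word_le u v -> word_le v w -> word_le u w.
Proof. exact: rt_trans. Qed.

Lemma knuth_step_ascent u w : knuth_step u w -> ascent_swap u w.
Proof.
case=> A [_ [_ [B [[x y z h1 h2|x y z h1 h2] -> ->]]]].
  by exists (rcons A y), x, z, B; rewrite !cat_rcons; split=> //; lia.
by exists A, x, z, (y :: B); split=> //; lia.
Qed.

Lemma plactic_word_le u w : plactic u w -> word_le u w.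
Proof.
move=> uw; suff [] : word_le u w /\ word_le w u by [].
elim: uw => {u w} [u w k|u|u w _ []|u v w _ [uv vu] _ [vw wv]] //.
- split; apply: rt_step; last by right.
  by left; apply: knuth_step_ascent.
- by split; apply: word_le_refl.
- by split; [apply: word_le_trans uv vw|apply: word_le_trans wv vu].
Qed.

Lemma word_le_cat A B u w : word_le u w -> word_le (A ++ u ++ B) (A ++ w ++ B).
Proof.
elim=> {u w} [u w h|u|u v w _ uv _].
- apply: rt_step; case: h => [[A' [x [y [B' [lt_xy -> ->]]]]]|].
    by left; exists (A ++ A'), x, y, (B' ++ B); rewrite -!catA.
  case=> A' [p [q [B' [kpq -> ->]]]].
  by right; exists (A ++ A'), p, q, (B' ++ B); rewrite -!catA.
- exact: word_le_refl.
- exact: word_le_trans.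
Qed.

Lemma word_le_swap A B x y : x < y ->
  word_le (A ++ [:: x, y & B]) (A ++ [:: y, x & B]).
Proof. by move=> lt_xy; apply: rt_step; left; exists A, x, y, B. Qed.

Lemma plactic_perm u w : plactic u w -> perm_eq u w.
Proof.
elim=> {u w} [u w [A [p [q [B [kpq -> ->]]]]]|u|u w _|u v w _ uv _ vw].
- rewrite perm_cat2l perm_cat2r; case: kpq => x y z _ _; apply/seq.permP => f /=; lia.
- exact: perm_refl.
- by rewrite perm_sym.
- exact: perm_trans uv vw.
Qed.

(** * Swaps across a block of large letters *)

(** Knuth moves push an ascent to the end of the word: when [e <= f] is followed
    by [g < f], either [efg] becomes [feg] with the ascent [e <= g], or it becomes
    [egf] with the ascent [g < f]. *)
Lemma plactic_last_ascent B :
  sorted gtn B \/ exists C z x, z <= x /\ plactic B (C ++ [:: z; x]).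
Proof.
elim: B => [|e B IH]; first by left.
case: IH => [s_B | [C [z [x [le_zx pB]]]]]; last first.
  by right; exists (e :: C), z, x; split=> //; apply: plactic_cons.
case: B s_B => [|f B] /= p_B; first by left.
have [lt_fe | le_ef] := ltnP f e; [by left|right].
elim: B e f le_ef p_B => [|g B IH] e f le_ef /=.
  by exists [::], e, f; split=> //; apply: plactic_refl.
case/andP=> lt_gf p_B; have [le_eg | lt_ge] := leqP e g.
  have [C [z [x [le_zx p]]]] := IH e g le_eg p_B.
  exists (f :: C), z, x; split=> //.
  by apply: plactic_trans (plactic_acb _ le_eg lt_gf) (plactic_cons f p).
have p_fB : path gtn f B.
  by case: (B) p_B => //= h B' /andP[lt_hg ->]; rewrite (ltn_trans lt_hg lt_gf).
have [C [z [x [le_zx p]]]] := IH g f (ltnW lt_gf) p_fB.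
exists (e :: C), z, x; split=> //.
exact: plactic_trans (plactic_sym (plactic_bac _ lt_ge le_ef)) (plactic_cons e p).
Qed.

(** Symmetrically, a descent can be pushed to the beginning of the word. *)
Lemma plactic_first_descent B :
  sorted leq B \/ exists C x z, z < x /\ plactic B [:: x, z & C].
Proof.
elim/last_ind: B => [|B e IH]; first by left.
case: IH => [s_B | [C [x [z [lt_zx pB]]]]]; last first.
  right; exists (rcons C e), x, z; split=> //.
  by rewrite -!cats1; apply: (plactic_catr [:: e] pB).
case/lastP: B s_B => [|B f] s_B; first by left.
have [le_fe | lt_ef] := leqP f e.
  left; move: s_B; rewrite !(sorted_pairwise leq_trans) (pairwise_rcons _ _ e) => s_B.
  rewrite s_B andbT; move: s_B; rewrite pairwise_rcons all_rcons le_fe => /andP[le_B _].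
  by apply/allP => g /(allP le_B) /= /leq_trans; apply.
right; elim/last_ind: B e f lt_ef s_B => [|B g IH] e f lt_ef s_B.
  by exists [::], f, e; split=> //; apply: plactic_refl.
move: s_B; rewrite (sorted_pairwise leq_trans) pairwise_rcons all_rcons.
case/andP=> /andP[le_gf le_Bf] s_Bg.
have [le_ge | lt_eg] := leqP g e.
  have s_Bf : sorted leq (rcons B f).
    rewrite (sorted_pairwise leq_trans) pairwise_rcons le_Bf.
    by move: s_Bg; rewrite pairwise_rcons => /andP[].
  have [C [x [z [lt_zx p]]]] := IH g f (leq_ltn_trans le_ge lt_ef) s_Bf.
  exists (rcons C e), x, z; split=> //.
  have := plactic_catr [:: e] p; rewrite /= !cats1 => p1; apply: (plactic_trans _ p1).
  by rewrite -!cats1 -!catA; apply/plactic_catl/plactic_acb.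
rewrite -(sorted_pairwise leq_trans) in s_Bg.
have [C [x [z [lt_zx p]]]] := IH e g lt_eg s_Bg.
exists (rcons C f), x, z; split=> //.
have := plactic_catr [:: f] p; rewrite /= !cats1 => p1; apply: (plactic_trans _ p1).
by rewrite -!cats1 -!catA; apply/plactic_catl/plactic_sym/plactic_bac.
Qed.

(** By induction on the block. If it ends with an ascent [z <= x], then both [a]
    and [c] may jump over the last letter [x], because [z] lies between them and
    [x]; this shortens the block. Otherwise it is a decreasing word [Dd], and then
    the two words are Knuth equivalent to [Dbacd] and [Dbadc], which differ by one
    ascent swap. *)
Lemma word_le_far_descent a b c B : a < b -> b < c -> all (ltn c) B ->
  word_le (b :: c :: B ++ [:: a]) (b :: a :: B ++ [:: c]).
Proof.
move=> lt_ab lt_bc; have [m] := ubnP (size B); elim: m B => // m IH B.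
rewrite ltnS => le_Bm lt_cB.
case: (plactic_last_ascent B) => [s_B | [C [z [x [le_zx pB]]]]].
  case/lastP: B s_B lt_cB {le_Bm IH} => [|D d] s_B.
    by move=> _; apply/plactic_word_le/plactic_sym/plactic_bac => //; apply: ltnW.
  rewrite all_rcons => /andP[] /= lt_cd lt_cD.
  have lt_cB : all (ltn c) (rcons D d) by rewrite all_rcons /= lt_cd.
  have lt_bD e : e < c -> all (ltn e) D.
    by move=> lt_ec; apply: sub_all lt_cD => f; apply: ltn_trans.
  have s_Dc : sorted gtn (rcons D c).
    case/lastP: D s_B lt_cD {lt_cB lt_bD} => // D f.
    rewrite -!cats1 -!catA /= !sorted_cat_cons => /andP[-> _].
    by rewrite all_cat /= => /and3P[_ lt_cf _]; rewrite andbT.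
  have lt_bd : b < d by apply: ltn_trans lt_cd.
  (* [b] and [c] move right through the decreasing block, then [a] moves left
     past [d] and [c]. *)
  apply: (@word_le_trans (D ++ [:: b; a; c; d])).
    apply: plactic_word_le.
    apply: plactic_trans
      (plactic_cons b (plactic_catr [:: a] (small_moves_right s_B lt_cB))) _.
    rewrite -catA /= -cat_rcons -cat_cons.
    have lt_bDc : all (ltn b) (rcons D c) by rewrite all_rcons /= lt_bc lt_bD.
    apply: plactic_trans (plactic_catr _ (small_moves_right s_Dc lt_bDc)) _.
    rewrite -catA /=; apply: plactic_catl.
    apply: plactic_trans
      (plactic_cons b (plactic_sym (plactic_bac _ _ (ltnW lt_cd)))) _.
      exact: ltn_trans lt_bc.
    exact/plactic_sym/plactic_bac/ltnW.
  apply: (@word_le_trans (D ++ [:: b; a; d; c])).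
    by have := word_le_swap (D ++ [:: b; a]) [::] lt_cd; rewrite -!catA.
  apply/plactic_word_le/plactic_sym.
  have lt_aB : all (ltn a) (rcons D d).
    by rewrite all_rcons /= (lt_bD a) ?andbT; lia.
  apply: plactic_trans
    (plactic_cons b (plactic_catr [:: c] (small_moves_right s_B lt_aB))) _.
  rewrite -catA /=.
  have p1 : plactic [:: a; d; c] [:: d; a; c] by apply: plactic_acb; lia.
  apply: plactic_trans (plactic_cons b (plactic_catl D p1)) _.
  have lt_bB : all (ltn b) (rcons D d) by rewrite all_rcons /= lt_bd (lt_bD b).
  rewrite -cat_rcons -cat_cons.
  apply: plactic_trans (plactic_catr _ (small_moves_right s_B lt_bB)) _.
  rewrite -catA /=; apply: plactic_catl.
  exact/plactic_sym/plactic_bac/ltnW.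
have eB := plactic_perm pB.
have : all (ltn c) (C ++ [:: z; x]) by rewrite -(perm_all _ eB).
rewrite all_cat /= andbT => /and3P[lt_cC lt_cz lt_cx].
have pBctx e f : plactic [:: b, e & B ++ [:: f]] [:: b, e & C ++ [:: z; x; f]].
  by have := plactic_cat [:: b; e] [:: f] pB; rewrite /= -catA.
apply: word_le_trans (plactic_word_le (pBctx c a)) _.
apply: word_le_trans (plactic_word_le (plactic_sym (pBctx a c))).
have p1 e : e < z -> plactic [:: z; x; e] [:: z; e; x].
  by move=> lt_ez; apply/plactic_sym/plactic_bac.
apply: word_le_trans (plactic_word_le (plactic_catl [:: b, c & C] (p1 a _))) _; first by lia.
apply: word_le_trans (plactic_word_le (plactic_sym (plactic_catl [:: b, a & C] (p1 c lt_cz)))).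
have lt_cCz : all (ltn c) (rcons C z) by rewrite all_rcons /= lt_cz.
have le_Czm : size (rcons C z) < m.
  by move: le_Bm; rewrite (perm_size eB) size_cat size_rcons /= addn2.
have := word_le_cat [::] [:: x] (IH _ le_Czm lt_cCz).
by rewrite /= -!cats1 -!catA.
Qed.

(** The mirror argument: a descent at the beginning of the block lets its first
    letter leave to the left, and for an increasing block [xE] the two words are
    Knuth equivalent to [cxabE] and [xcabE]. *)
Lemma word_le_far_ascent a b c B : a < b -> b < c -> all (ltn c) B ->
  word_le (c :: B ++ [:: a; b]) (a :: B ++ [:: c; b]).
Proof.
move=> lt_ab lt_bc; have [m] := ubnP (size B); elim: m B => // m IH B.
rewrite ltnS => le_Bm lt_cB; have lt_ac := ltn_trans lt_ab lt_bc.
case: (plactic_first_descent B) => [s_B | [C [x [z [lt_zx pB]]]]].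
  case: B s_B lt_cB {le_Bm IH} => [|x E] /= s_B.
    by move=> _; apply/plactic_word_le/plactic_sym/plactic_acb => //; apply: ltnW.
  case/andP=> lt_cx lt_cE.
  have p_E e : e <= c -> path leq e E.
    move=> le_ec; case: (E) s_B lt_cE => //= f E' /andP[_ ->] /andP[lt_cf _].
    by rewrite andbT; lia.
  apply: (@word_le_trans [:: c, x, a, b & E]).
    apply: plactic_word_le; rewrite -[[:: a; b]]cat1s catA.
    have lt_ax : a < x by lia.
    apply: plactic_trans (plactic_cons c (plactic_catr [:: b] (small_moves_left lt_ax s_B))) _.
    rewrite /=; apply: plactic_trans (plactic_sym (plactic_bac _ lt_ac (ltnW lt_cx))) _.
    have lt_bx : b < x by lia.
    apply: plactic_trans (plactic_cons c (plactic_cons a (small_moves_left lt_bx s_B))) _.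
    exact/plactic_cons/plactic_acb/lt_bx/ltnW.
  apply: word_le_trans (word_le_swap [::] [:: a, b & E] lt_cx) _.
  apply/plactic_word_le/plactic_sym.
  rewrite -[[:: c; b]]cat1s catA.
  apply: plactic_trans (plactic_cons a (plactic_catr [:: b] (small_moves_left lt_cx s_B))) _.
  rewrite /=.
  have p_cE : path leq c E by apply: p_E.
  apply: plactic_trans (plactic_cons a (plactic_cons x (small_moves_left lt_bc p_cE))) _.
  rewrite /=; apply: plactic_trans (plactic_acb _ (ltnW lt_ac) lt_cx) _.
  by apply/plactic_cons/plactic_acb => //; apply: ltnW.
have eB := plactic_perm pB.
have : all (ltn c) [:: x, z & C] by rewrite -(perm_all _ eB).
rewrite /= => /and3P[lt_cx lt_cz lt_cC].
have pBctx e f : plactic (e :: B ++ f) [:: e, x, z & C ++ f].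
  by have := plactic_cat [:: e] f pB.
apply: word_le_trans (plactic_word_le (pBctx c _)) _.
apply: word_le_trans (plactic_word_le (plactic_sym (pBctx a _))).
apply: word_le_trans (plactic_word_le (plactic_acb _ (ltnW lt_cz) lt_zx)) _.
apply: word_le_trans (plactic_word_le (plactic_sym (plactic_acb _ _ lt_zx))); last by lia.
have lt_czC : all (ltn c) (z :: C) by rewrite /= lt_cz.
have le_zCm : size (z :: C) < m by move: le_Bm; rewrite (perm_size eB).
by have := word_le_cat [:: x] [::] (IH _ le_zCm lt_czC); rewrite /= !cats0.
Qed.

(** * Small and large letters under insertion *)

Definition low k (w : seq nat) := [seq x <- w | x <= k].
Definition high k (w : seq nat) := [seq x <- w | k < x].

Lemma low_high k r : pairwise leq r -> r = low k r ++ high k r.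
Proof.
elim: r => //= x r IH /andP[le_x s_r]; have [le_xk|lt_kx] := leqP x k.
  by rewrite /= -IH.
suff e : low k r = [::] by rewrite {2}(IH s_r) /low in e *; rewrite e.
apply/eqP; rewrite -(negbK (_ == _)) -has_filter; apply/hasPn => y /(allP le_x) /=.
by rewrite -ltnNge; apply: leq_trans.
Qed.

Lemma low_all_high k x r : k < x -> all (leq x) r -> low k r = [::].
Proof.
move=> lt_kx le_x; apply/eqP; rewrite -(negbK (_ == _)) -has_filter.
by apply/hasPn => y /(allP le_x) /= le_xy; rewrite -ltnNge; apply: leq_trans le_xy.
Qed.

Lemma row_insert_high k x r : k < x ->
  [/\ low k (row_insert x r).1 = low k r,
      high k (row_insert x r).1 = (row_insert x (high k r)).1,
      (row_insert x r).2 = (row_insert x (high k r)).2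
    & forall y, (row_insert x r).2 = Some y -> k < y].
Proof.
move=> lt_kx; elim: r => [|h t [IH1 IH2 IH3 IH4]] /=; first by rewrite leqNgt lt_kx.
have [lt_xh|le_hx] := ltnP x h.
  have lt_kh := ltn_trans lt_kx lt_xh.
  by rewrite /= lt_kx lt_kh leqNgt lt_kx /= leqNgt lt_kh lt_xh; split=> // y [<-].
case: (row_insert x t) IH1 IH2 IH3 IH4 => t1 o /= -> -> -> oP.
case: (ltnP k h) => // lt_kh; rewrite /= ltnNge le_hx.
by case: (row_insert x (high k t)) oP.
Qed.

Lemma row_insert_low k x r : x <= k -> pairwise leq r ->
  (row_insert x (low k r)).1 = low k (row_insert x r).1 /\
  match (row_insert x r).2 with
  | None => [/\ (row_insert x (low k r)).2 = None, high k r = [::],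
      high k (row_insert x r).1 = [::] &
      size (low k (row_insert x r).1) = (size (low k r)).+1]
  | Some y => if y <= k then
      [/\ (row_insert x (low k r)).2 = Some y,
          high k (row_insert x r).1 = high k r &
          size (low k (row_insert x r).1) = size (low k r)]
    else [/\ (row_insert x (low k r)).2 = None,
          high k r = y :: high k (row_insert x r).1 &
          size (low k (row_insert x r).1) = (size (low k r)).+1]
  end.
Proof.
move=> le_xk; elim: r => [|h t IH] /=; first by rewrite le_xk ltnNge le_xk.
case/andP=> le_h s_t; have [lt_xh|le_hx] := ltnP x h.
  have [le_hk|lt_kh] := leqP h k; first by decide_comparisons.
  rewrite (low_all_high lt_kh le_h); decide_comparisons.
  by rewrite (low_all_high lt_kh le_h).
move: IH => /(_ s_t); rewrite (leq_trans le_hx le_xk) /= ltnNge le_hx /=.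
have := leq_trans le_hx le_xk; case: (row_insert x t) => t1 o /=.
case: (row_insert x (low k t)) => t2 o2 /= le_hk [->].
case: o => [y|] /=; last by decide_comparisons; case=> -> -> -> ->.
by decide_comparisons; case: (leqP y k) => _ [-> -> ->].
Qed.

Lemma tableau_insert_high k T x i : k < x ->
  low k (nth [::] (tableau_insert T x) i) = low k (nth [::] T i).
Proof.
elim: T x i => [|r T IH] x i lt_kx.
  by case: i => [|[|i]] //=; rewrite leqNgt lt_kx.
rewrite /=; have [e _ _ oP] := row_insert_high r lt_kx.
case: (row_insert x r) e oP => r1 [y|] /= e oP; case: i => //= i.
exact/IH/oP.
Qed.

(** A letter greater than [k] never bumps one that is at most [k], so the entries
    at most [k] evolve on their own. *)
Lemma tableau_insert_low k P P0 x : x <= k -> all (pairwise leq) P ->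
  (forall i, nth [::] P0 i = low k (nth [::] P i)) ->
  forall i, nth [::] (tableau_insert P0 x) i = low k (nth [::] (tableau_insert P x) i).
Proof.
move=> le_xk s_P e.
(* Insertion does not distinguish a missing row from an empty one, which allows
   the two tableaux to be split into rows in parallel. *)
pose P0' := if P0 is [::] then [:: [::]] else P0.
have -> : tableau_insert P0 x = tableau_insert P0' x by rewrite /P0'; case: (P0).
have {e} : forall i, nth [::] P0' i = low k (nth [::] P i).
  by move=> i; rewrite -e /P0'; case: (P0) => //; case: i => [|[|i]].
have : P0' <> [::] by rewrite /P0'; case: (P0).
move: P0' => {}P0; elim: P P0 x le_xk s_P => [|r P IH] [|r0 P0] x le_xk //=.
  move=> _ _ e i; have /= -> := e 0; have {}e j : nth [::] P0 j = [::] by have := e j.+1.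
  by case: i => [|[|i]] //=; rewrite ?le_xk ?e // nth_nil.
case/andP=> s_r s_P _ e i; have /= -> := e 0.
have {}e j : nth [::] P0 j = low k (nth [::] P j) by have := e j.+1.
have [] := row_insert_low le_xk s_r.
case: (row_insert x r) => r1 o; case: (row_insert x (low k r)) => r2 o2 /= ->.
case: o => [y|] /= => [|[-> _ _ _]]; last by case: i.
have [le_yk|lt_ky] := leqP y k; last first.
  by case=> -> _ _; case: i => //= i; rewrite tableau_insert_high.
case=> -> _ _; case: i => //= i.
case: P0 e => [|r' P0'] e; last by apply: IH.
have /= <- := IH [:: [::]] y le_yk s_P _ _ i => //.
by move=> j; rewrite -e; case: j => [|[|j]].
Qed.

Lemma tab_word_sorted w : all (pairwise leq) (tab_word w).
Proof. exact: foldl_tableau_insert_sorted. Qed.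

Lemma tab_word_rcons w x : tab_word (rcons w x) = tableau_insert (tab_word w) x.
Proof. exact: foldl_rcons. Qed.

Lemma low_rcons k w x :
  low k (rcons w x) = if x <= k then rcons (low k w) x else low k w.
Proof. exact: filter_rcons. Qed.

Lemma low_cat k u w : low k (u ++ w) = low k u ++ low k w.
Proof. exact: filter_cat. Qed.

Lemma tab_word_low k w i :
  nth [::] (tab_word (low k w)) i = low k (nth [::] (tab_word w) i).
Proof.
elim/last_ind: w i => [|w x IH] i; first by rewrite !nth_nil.
rewrite low_rcons tab_word_rcons.
case: (leqP x k) => [le_xk|lt_kx]; last by rewrite tableau_insert_high.
by rewrite tab_word_rcons; apply: tableau_insert_low => //; apply: tab_word_sorted.
Qed.

Lemma tab_word_nonempty_rows w : all (fun r => r != [::]) (tab_word w).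
Proof.
elim/last_ind: w => // w x; rewrite tab_word_rcons.
elim: (tab_word w) x => //= r T IH x /andP[r0 T0].
case: row_insertP => [_|r1 y r2 _ _ _] /=; first by rewrite T0 -cats1; case: (r).
by rewrite IH ?andbT //; case: (r1).
Qed.

Lemma inner_tableau_tab_word k w : inner_tableau k (tab_word w) = tab_word (low k w).
Proof.
rewrite /inner_tableau; have := tab_word_nonempty_rows (low k w).
have := @tab_word_low k w; move: (tab_word (low k w)) => P0.
elim: (tab_word w) P0 => [|r P IH] [|r0 P0] //= e.
- by have /= -> := e 0.
- have /= := e 0; rewrite /low => <- _ /=; apply: (IH [::]) => // i.
  by have /= <- := e i.+1; rewrite nth_nil.
- have /= e0 := e 0; rewrite /low in e0; rewrite -e0.
  by case/andP=> r0n P0n; rewrite r0n (IH P0) // => i; have := e i.+1.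
Qed.

(** For sorted rows this says that the two tableaux have the same cells, and the
    same entries outside the cells of the entries at most [k]. *)
Definition same_outer k : tableau -> tableau -> bool :=
  all2 (fun r r' => (size (low k r) == size (low k r')) && (high k r == high k r')).

Lemma same_outer_high k T T' x : k < x -> same_outer k T T' ->
  same_outer k (tableau_insert T x) (tableau_insert T' x).
Proof.
elim: T T' x => [|r T IH] [|r' T'] x lt_kx //=; first by rewrite !eqxx.
case/andP=> /andP[/eqP e1 /eqP e2] so.
have [lr hr or yP] := row_insert_high r lt_kx.
have [lr' hr' or' _] := row_insert_high r' lt_kx.
rewrite -e2 in hr' or'.
move: lr hr or yP lr' hr' or'.
case: (row_insert x r) => r1 o; case: (row_insert x r') => r1' o' /=.
move=> lr hr or yP lr' hr' or'.
move: or' yP; rewrite -or => ->; case: o {or} => [y|] yP /=;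
  rewrite lr lr' hr hr' e1 !eqxx //=.
exact: IH (yP _ erefl) so.
Qed.

(** The insertion path of a small letter stays among the small entries up to the
    row in which their number grows. By hypothesis this is the same row in both
    tableaux; there the path meets the same large entry, if any, and continues in
    the same way. *)
Lemma same_outer_low k T T' x x' : x <= k -> x' <= k ->
  all (pairwise leq) T -> all (pairwise leq) T' -> same_outer k T T' ->
  (forall i, size (low k (nth [::] (tableau_insert T x) i)) =
             size (low k (nth [::] (tableau_insert T' x') i))) ->
  same_outer k (tableau_insert T x) (tableau_insert T' x').
Proof.
elim: T T' x x' => [|r T IH] [|r' T'] x x' le_xk le_xk' //=.
  by move=> _ _ _ /(_ 0) /= ->; rewrite !ltnNge le_xk le_xk'.
case/andP=> s_r s_T /andP[s_r' s_T'] /andP[/andP[/eqP e1 /eqP e2] so].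
have [_] := row_insert_low le_xk s_r; have [_] := row_insert_low le_xk' s_r'.
case: (row_insert x r) => r1 o; case: (row_insert x' r') => r1' o' /=.
case: o' => [y'|] /=; [case: (leqP y' k) => y'k [_ h' sz']|case=> _ h' h1' sz'];
  (case: o => [y|] /=; [case: (leqP y k) => yk [_ h sz]|case=> _ h h1 sz]) => e;
  have /= e0 := e 0; try (exfalso; lia); rewrite e0 eqxx /=.
- by rewrite h h' e2 eqxx /=; apply: IH => // i; have := e i.+1.
- by move: e2; rewrite h h' => -[-> ->]; rewrite eqxx; apply: same_outer_high.
- by move: e2; rewrite h h'.
- by move: e2; rewrite h h'.
- by rewrite h1 h1' eqxx.
Qed.

Definition outer_letters k (w : seq nat) := [seq if x <= k then 0 else x | x <- w].

Lemma size_low k w : size (low k w) = count_mem 0 (outer_letters k w).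
Proof.
rewrite size_filter count_map; apply: eq_count => x /=.
by case: (leqP x k) => //; case: x.
Qed.

Lemma tab_word_same_outer k u u' :
  outer_letters k u = outer_letters k u' ->
  (forall p s p' s', low k u = p ++ s -> low k u' = p' ++ s' -> size p = size p' ->
     shape (tab_word p) = shape (tab_word p')) ->
  same_outer k (tab_word u) (tab_word u').
Proof.
elim/last_ind: u u' => [|u x IH] u'; first by case: u'.
case/lastP: u' => [|u' x'] => /(congr1 (fun w => (size w, rev w))).
  by rewrite /outer_letters size_map size_rcons.
rewrite /outer_letters !map_rcons !rev_rcons => -[_ ex /(congr1 rev)].
rewrite !revK => eu shP; rewrite !tab_word_rcons.
have so : same_outer k (tab_word u) (tab_word u').
  apply: IH eu _ => p s p' s' ep ep'.
  apply: (shP _ (if x <= k then rcons s x else s) _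
    (if x' <= k then rcons s' x' else s')).
    by rewrite low_rcons ep; case: ifP; rewrite // rcons_cat.
  by rewrite low_rcons ep'; case: ifP; rewrite // rcons_cat.
move: ex; case: (leqP x k) => [le_xk|lt_kx]; case: leqP => le_xk' ex.
- apply: same_outer_low => //; try exact: tab_word_sorted.
  move=> i; rewrite -!tab_word_rcons -!tab_word_low !low_rcons le_xk le_xk'.
  have := congr1 (fun s => nth 0 s i) (shP (low k (rcons u x)) [::]
    (low k (rcons u' x')) [::] _ _ _).
  rewrite !cats0 !low_rcons le_xk le_xk' /shape => /(_ erefl erefl).
  have sz : size (low k u) = size (low k u') by rewrite !size_low /outer_letters eu.
  by rewrite !size_rcons sz -!nth_shape => /(_ erefl) ->.
- by move: le_xk'; rewrite -ex.
- by move: lt_kx; rewrite ex.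
- by subst x'; apply: same_outer_high.
Qed.

Lemma inner_translation_tab_word k u u' :
  same_outer k (tab_word u) (tab_word u') ->
  inner_translation (tab_word (low k u)) (tab_word (low k u')) (tab_word u) =
  tab_word u'.
Proof.
move=> so; have sz : size (tab_word u) = size (tab_word u').
  by elim: (tab_word u) (tab_word u') so => [|r T IH] [|r' T'] //= /andP[_ /IH ->].
apply: (@eq_from_nth _ [::]); first by rewrite size_mkseq.
move=> i; rewrite size_mkseq => lt_i; rewrite nth_mkseq // !tab_word_low.
have s_i w : pairwise leq (nth [::] (tab_word w) i).
  have [lt_iw|le_wi] := ltnP i (size (tab_word w)); last by rewrite nth_default.
  by apply: (allP (tab_word_sorted w)); apply: mem_nth.
have : high k (nth [::] (tab_word u) i) = high k (nth [::] (tab_word u') i).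
  elim: (tab_word u) (tab_word u') so i {lt_i s_i sz} => [|r T IH] [|r' T'] //=.
  by case/andP=> /andP[_ /eqP e] so [|i] //=; apply: IH.
by move=> eh; rewrite [RHS](low_high k (s_i u')) -eh {2}(low_high k (s_i u)) drop_size_cat.
Qed.

(** * Words inserting to a hook *)

Definition descents (w : seq nat) : seq bool :=
  if w is x :: w' then pairmap (fun a b => b < a) x w' else [::].

Lemma descents_cat A x B :
  descents (A ++ x :: B) = descents (rcons A x) ++ descents (x :: B).
Proof. by case: A => [|a A] //=; rewrite -cat_rcons pairmap_cat last_rcons. Qed.

Lemma descents_rcons A x y :
  descents (rcons (rcons A x) y) = rcons (descents (rcons A x)) (y < x).
Proof. by rewrite -[rcons (rcons A x) y]cats1 cat_rcons descents_cat cats1. Qed.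

Lemma descents_cat3 A x y z B : descents (A ++ [:: x, y, z & B]) =
  descents (rcons A x) ++ [:: y < x, z < y & descents (z :: B)].
Proof. exact: descents_cat. Qed.

Lemma size_descents w : size (descents w) = (size w).-1.
Proof. by case: w => //= x w; rewrite size_pairmap. Qed.

Definition column (c : seq nat) : tableau := [seq [:: x] | x <- c].

(** Unlike being a hook, having no cell (2,2) makes sense for the empty tableau,
    and it obviously passes to the insertion tableaux of prefixes. *)
Definition hookish (T : tableau) : bool := size (nth [::] T 1) <= 1.

Lemma size_row_tableau_insert T x i :
  size (nth [::] T i) <= size (nth [::] (tableau_insert T x) i).
Proof.
elim: T x i => [|r T IH] x i; first by rewrite nth_nil.
rewrite /=; case: row_insertP => [_|r1 y r2 -> _ _]; case: i => //=.
  by rewrite size_rcons.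
by rewrite !size_cat.
Qed.

Lemma hookish_prefix u w : hookish (tab_word (u ++ w)) -> hookish (tab_word u).
Proof.
elim/last_ind: w => [|w x IH]; first by rewrite cats0.
rewrite -rcons_cat tab_word_rcons => h; apply: IH.
exact: leq_trans (size_row_tableau_insert _ x 1) h.
Qed.

Lemma column_insert y c : path ltn y c -> tableau_insert (column c) y = column (y :: c).
Proof. by elim: c y => //= z c IH y /andP[-> /IH ->]. Qed.

(** As long as no cell (2,2) appears, a letter adds a cell to the column if it is
    smaller than the preceding letter [x0], and to the row otherwise. Indeed [x0]
    is in the first row, so a smaller letter bumps. The last clause is the reason
    for the converse: if a letter [x >= x0] bumped an entry, this entry would be at
    least the one in cell (2,1) and would be placed next to it, in cell (2,2). *)
Lemma hook_insertion w x0 : hookish (tab_word (rcons w x0)) ->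
  exists r c, [/\ tab_word (rcons w x0) = r :: column c, sorted ltn c,
    size c = count id (descents (rcons w x0)), x0 \in r &
    forall e, e \in r -> x0 < e -> c <> [::] /\ head 0 c <= e].
Proof.
elim/last_ind: w x0 => [|w x0 IH] x.
  move=> _; exists [:: x], [::]; split=> //=; rewrite ?mem_head // => e.
  by rewrite inE => /eqP ->; rewrite ltnn.
move=> hk; have hk0 : hookish (tab_word (rcons w x0)).
  by apply: (@hookish_prefix _ [:: x]); rewrite cats1.
have [r [c [tE s_c sz_c x0_r cP]]] := IH _ hk0.
move: hk; rewrite tab_word_rcons tE descents_rcons.
have s_r : pairwise leq r.
  by have := tab_word_sorted (rcons w x0); rewrite tE => /andP[].
rewrite -cats1 count_cat /=.
case: row_insertP => [le_r _ | r1 y r2 rE le_r1 lt_xy].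
  have le_x : x0 <= x by apply: (allP le_r).
  exists (rcons r x), c; split=> //.
  - by rewrite sz_c ltnNge le_x !addn0.
  - by rewrite mem_rcons mem_head.
  - by move=> e; rewrite mem_rcons inE => /orP[/eqP ->|/(allP le_r)]; lia.
have y_r : y \in r by rewrite rE mem_cat inE eqxx orbT.
move=> hk; have p_c : path ltn y c.
  case: c {tE sz_c cP} s_c hk => //= c1 c -> ; rewrite /hookish /=.
  by case: ltnP.
have lt_x0 : x < x0.
  rewrite ltnNge; apply/negP => le_x0; have [] := cP y y_r; first by lia.
  by case: (c) p_c => //= c1 c' /andP[]; lia.
exists (r1 ++ x :: r2), (y :: c); split=> //.
- by rewrite column_insert.
- by rewrite /= sz_c lt_x0 addn0 addn1.
- by rewrite mem_cat inE eqxx orbT.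
move=> e; rewrite mem_cat inE => /or3P[/(allP le_r1)|/eqP->|e_r2] /=; try lia.
move: s_r; rewrite rE pairwise_cat /= => /and3P[_ _ /andP[/allP le_y _]] _.
by split=> //; apply: le_y.
Qed.

Lemma hook_tab_word x w : hookish (tab_word (x :: w)) ->
  exists r c, [/\ tab_word (x :: w) = r :: column c, sorted ltn c,
    size c = count id (descents (x :: w)) & size r + size c = size (x :: w)].
Proof.
have : x :: w != [::] by []; case/lastP: (x :: w) => {x w} [|w x] // _ /hook_insertion.
case=> r [c [tE s_c sz_c _ _]]; exists r, c; split=> //.
rewrite -(perm_size (tab_word_perm (rcons w x))) tE /= size_cat; congr addn.
by elim: (c) => //= y c' ->.
Qed.

Lemma shape_hook_tab_word x w : hookish (tab_word (x :: w)) ->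
  shape (tab_word (x :: w)) =
  size (x :: w) - count id (descents (x :: w)) :: nseq (count id (descents (x :: w))) 1.
Proof.
case/hook_tab_word => r [c [-> _ <- <-]] /=; rewrite addnK; congr cons.
by elim: c => //= y c ->.
Qed.

Lemma count_descents_hook u w : hookish (tab_word u) -> tab_word u = tab_word w ->
  count id (descents u) = count id (descents w).
Proof.
move=> hu e; have : size u = size w.
  by rewrite -(perm_size (tab_word_perm u)) e (perm_size (tab_word_perm w)).
case: u w hu e => [|x u] [|y w] //= hu e _.
have hw : hookish (tab_word (y :: w)) by rewrite -e.
have [r [c [tE _ <- _]]] := hook_tab_word hu.
have [r' [c' [tE' _ <- _]]] := hook_tab_word hw.
have := congr1 size e; rewrite tE tE' /= !size_map; lia.
Qed.

Lemma shape_hook_prefix p s p' s' :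
  hookish (tab_word (p ++ s)) -> hookish (tab_word (p' ++ s')) ->
  descents (p ++ s) = descents (p' ++ s') -> size p = size p' ->
  shape (tab_word p) = shape (tab_word p').
Proof.
move=> /hookish_prefix hp /hookish_prefix hp' e sz.
have {}e : descents p = descents p'.
  case/lastP: p sz e {hp hp'} => [|p x]; first by case: p'.
  case/lastP: p' => [|p' x']; rewrite ?size_rcons // => sz.
  rewrite !cat_rcons (descents_cat p) (descents_cat p').
  move/eqP; rewrite eqseq_cat => [/andP[/eqP]|] //.
  by rewrite !size_descents !size_rcons sz.
case: p hp sz e => [|x p] hp sz e; case: p' hp' sz e => [|x' p'] hp' //= sz e.
rewrite !shape_hook_tab_word //= e; congr (_ - _ :: _); lia.
Qed.

(** The Knuth partner of a triple that is neither increasing nor decreasing. In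
    such a triple [y] is the smallest or the largest letter, so the middle value
    is [x] or [z]; it serves as the witness for exchanging the other two. *)
Definition flip3 x y z : seq nat :=
  if (x < z) == (y < x) then [:: x; z; y] else [:: y; x; z].

Lemma flip3_knuth x y z : uniq [:: x; y; z] -> (y < x) != (z < y) ->
  knuth3 [:: x; y; z] (flip3 x y z) \/ knuth3 (flip3 x y z) [:: x; y; z].
Proof.
rewrite /= !inE /flip3 => un alt.
have [lt_yx|le_xy] := ltnP y x; have [lt_xz|le_zx] := ltnP x z => /=.
- by left; apply: Knuth_bac; lia.
- by right; apply: Knuth_acb; lia.
- by left; apply: Knuth_acb; lia.
- by right; apply: Knuth_bac; lia.
Qed.

Lemma knuth3_flip (p q : seq nat) : uniq p -> knuth3 p q \/ knuth3 q p ->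
  exists x y z, [/\ p = [:: x; y; z], q = flip3 x y z & (y < x) != (z < y)].
Proof.
move=> un [k|k]; case: k un => x y z h1 h2; rewrite /= !inE => un.
- by exists y, x, z; rewrite /flip3; split=> //; [rewrite ifT //|]; apply/eqP; lia.
- by exists x, z, y; rewrite /flip3; split=> //; [rewrite ifN //|]; apply/eqP; lia.
- by exists y, z, x; rewrite /flip3; split=> //; [rewrite ifT //|]; apply/eqP; lia.
- by exists z, x, y; rewrite /flip3; split=> //; [rewrite ifN //|]; apply/eqP; lia.
Qed.

Lemma flip3_tab A B x y z : uniq [:: x; y; z] -> (y < x) != (z < y) ->
  tab_word (A ++ flip3 x y z ++ B) = tab_word (A ++ [:: x; y; z] ++ B).
Proof.
move=> un alt; apply: plactic_tab; apply/plactic_cat.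
by case: (flip3_knuth un alt) => /plactic_knuth3 // /plactic_sym.
Qed.

Lemma count_descents_last A x y :
  count id (descents (rcons A x)) = count id (descents (rcons A y)) ->
  descents (rcons A x) = descents (rcons A y).
Proof.
case/lastP: A => [|A t] //; rewrite !descents_rcons -!cats1 !count_cat /=.
by case: (x < t); case: (y < t) => // e; exfalso; move: e => /=; lia.
Qed.

Lemma count_descents_head x y B :
  count id (descents (x :: B)) = count id (descents (y :: B)) ->
  descents (x :: B) = descents (y :: B).
Proof.
case: B => //= t B.
by case: (t < x); case: (t < y) => // e; exfalso; move: e => /=; lia.
Qed.

Arguments descents : simpl never.

(** A Knuth move exchanges the ascent and the descent inside its triple. It might
    also change the comparison with one neighbour of the triple, but then the
    number of descents would change, and for a hook this number is the length of
    the column. *)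
Lemma descents_flip3 A B x y z : uniq [:: x; y; z] -> (y < x) != (z < y) ->
  hookish (tab_word (A ++ [:: x; y; z] ++ B)) ->
  descents (A ++ flip3 x y z ++ B) =
  descents (rcons A x) ++ [:: ~~ (y < x), ~~ (z < y) & descents (z :: B)].
Proof.
move=> un alt hk; have := count_descents_hook hk (esym (flip3_tab A B un alt)).
move: un; rewrite /= !inE /flip3 => un.
case: eqP => c; rewrite !descents_cat3 !count_cat /= => e.
  rewrite (_ : descents (y :: B) = descents (z :: B)); last first.
    by apply: count_descents_head; lia.
  by congr (_ ++ [:: _, _ & _]); apply/idP/idP; lia.
rewrite (_ : descents (rcons A y) = descents (rcons A x)); last first.
  by apply: count_descents_last; lia.
by congr (_ ++ [:: _, _ & _]); apply/idP/idP; lia.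
Qed.

Lemma descents_flip3_eq A A' B B' x y z x' y' z' :
  uniq [:: x; y; z] -> uniq [:: x'; y'; z'] -> size A = size A' ->
  (y < x) != (z < y) ->
  hookish (tab_word (A ++ [:: x; y; z] ++ B)) ->
  hookish (tab_word (A' ++ [:: x'; y'; z'] ++ B')) ->
  descents (A ++ [:: x; y; z] ++ B) = descents (A' ++ [:: x'; y'; z'] ++ B') ->
  [/\ (y' < x') = (y < x), (z' < y') = (z < y) &
   descents (A ++ flip3 x y z ++ B) = descents (A' ++ flip3 x' y' z' ++ B')].
Proof.
move=> un un' sz alt hk hk'; rewrite !descents_cat3 => /eqP.
rewrite eqseq_cat ?size_descents ?size_rcons ?sz // => /andP[/eqP eA].
case/eqP => e1 e2 eB; rewrite !descents_flip3 -?e1 -?e2 //.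
by rewrite eA eB.
Qed.

(** * Insertion tableaux are standard *)

Lemma col_increasing_nil r : col_increasing r [::].
Proof. by []. Qed.

Lemma col_increasing_cons a u b l :
  col_increasing (a :: u) (b :: l) = (a < b) && col_increasing u l.
Proof.
rewrite /col_increasing /= ltnS andbCA; congr (_ && (_ && _)).
by rewrite (iotaDl 1 0) all_map.
Qed.

Lemma col_increasing_row_insert x r r' :
  col_increasing r r' -> col_increasing (row_insert x r).1 r'.
Proof.
elim: r r' => [|a u IH] [|b l] //; rewrite col_increasing_cons => /andP[lt_ab ul].
rewrite /=; case: ltnP => [lt_xa|le_ax].
  by rewrite col_increasing_cons ul (ltn_trans lt_xa).
have := IH l ul; case: row_insert => u1 o /= u1l.
by rewrite col_increasing_cons lt_ab.
Qed.

Lemma col_increasing_bump x y r r' :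
  col_increasing r r' -> (row_insert x r).2 = Some y ->
  col_increasing (row_insert x r).1 (row_insert y r').1.
Proof.
elim: r r' => [|a u IH] r' //=; case: ltnP => [lt_xa|le_ax].
  case: r' => [|b l] ab [<-] /=; first by rewrite col_increasing_cons lt_xa.
  move: ab; rewrite col_increasing_cons => /andP[lt_ab ul].
  by rewrite lt_ab /= col_increasing_cons lt_xa.
have lt_xy : (row_insert x u).2 = Some y -> x < y.
  by case: row_insertP => // ? ? ? _ _ lt [<-].
case: r' => [|b l] ab.
  have := IH [::] (col_increasing_nil _); move: lt_xy.
  case: row_insert => u1 o /= lt_xy _ /lt_xy lt.
  by rewrite col_increasing_cons (leq_ltn_trans le_ax lt).
move: ab; rewrite col_increasing_cons => /andP[lt_ab ul].
have := IH l ul; have := col_increasing_row_insert x ul; move: lt_xy.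
case: row_insert => u1 o /= lt_xy u1l IHl oy; have := lt_xy oy; have := IHl oy.
rewrite /=; case: (ltnP y b) => [lt_yb|le_by]; case: (row_insert y l) => l1 o1 /= u1l1 lt;
  rewrite col_increasing_cons ?lt_ab //.
by rewrite (leq_ltn_trans le_ax lt).
Qed.

Lemma path_columns_insert r T x : path col_increasing r T ->
  path col_increasing (row_insert x r).1
    (if (row_insert x r).2 is Some y then tableau_insert T y else T).
Proof.
elim: T r x => [|r' T IH] r x /=.
  move=> _; have := @col_increasing_bump x _ r [::] (col_increasing_nil r).
  by case: row_insert => r1 [y|] //= /(_ y erefl) ->.
case/andP=> rr' p; have := col_increasing_row_insert x rr'.
have := @col_increasing_bump x _ r r' rr'.
case: row_insert => r1 [y|] /= b c; last by rewrite c.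
have := b y erefl; have := IH r' y p.
by case: row_insert => r2 [z|] /= -> ->.
Qed.

Lemma tableau_insert_columns T x :
  sorted col_increasing T -> sorted col_increasing (tableau_insert T x).
Proof.
case: T => //= r T /(path_columns_insert x).
by case: row_insert => r1 [y|].
Qed.

Lemma tab_word_columns w : sorted col_increasing (tab_word w).
Proof.
by elim/last_ind: w => // w x; rewrite tab_word_rcons; apply: tableau_insert_columns.
Qed.

Lemma tab_word_uniq_rows w : uniq w -> all (sorted ltn) (tab_word w).
Proof.
rewrite -(perm_uniq (tab_word_perm w)); move: (tab_word_sorted w).
elim: (tab_word w) => //= r T IH /andP[s_r s_T]; rewrite cat_uniq => /and3P[u_r _ u_T].
by rewrite IH // ltn_sorted_uniq_leq u_r (sorted_pairwise leq_trans) s_r.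
Qed.

Lemma tab_word_SYT n w : perm_eq w (iota 1 n) -> tab_word w \in SYT n.
Proof.
move=> pw; apply/and4P; split.
- exact: tab_word_nonempty_rows.
- by apply: tab_word_uniq_rows; rewrite (perm_uniq pw) iota_uniq.
- exact: tab_word_columns.
- exact: perm_trans (tab_word_perm w) pw.
Qed.

(** * Between two words of the same hook tableau *)

Definition first_row_insert (r w : seq nat) : seq nat :=
  foldl (fun r x => (row_insert x r).1) r w.

Definition first_row_size w := size (first_row_insert [::] w).

Lemma first_row_sizeE w : first_row_size w = size (nth [::] (tab_word w) 0).
Proof.
congr size; elim/last_ind: w => // w x; rewrite /first_row_insert foldl_rcons.
rewrite tab_word_rcons => ->.
case: (tab_word w) => [|r T] //=; by case: row_insert => r1 [y|].
Qed.

(** Entries are compared columnwise, missing entries counting as infinite: a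
    smaller row is longer. *)
Fixpoint row_le (r r' : seq nat) : bool :=
  match r, r' with
  | a :: t, b :: t' => (a <= b) && row_le t t'
  | _, [::] => true
  | _, _ => false
  end.

Lemma row_le_refl r : row_le r r.
Proof. by elim: r => //= a r ->; rewrite leqnn. Qed.

Lemma row_le_size r r' : row_le r r' -> size r' <= size r.
Proof. by elim: r r' => [|a r IH] [|b r'] //= /andP[_ /IH]. Qed.

Lemma row_le_nil r : row_le r [::]. Proof. by case: r. Qed.

Lemma row_le_insertl x r r' : row_le r r' -> row_le (row_insert x r).1 r'.
Proof.
elim: r r' => [|a t IH] [|b t'] //; first by move=> _; apply: row_le_nil.
rewrite /=; case: ltnP => [lt_xa|le_ax].
  by case/andP=> le_ab tt' /=; rewrite tt' (leq_trans (ltnW lt_xa)).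
by case/andP=> le_ab /IH; case: row_insert => t1 o /= ->; rewrite le_ab.
Qed.

Lemma row_le_insert x r r' :
  row_le r r' -> row_le (row_insert x r).1 (row_insert x r').1.
Proof.
elim: r r' => [|a t IH] [|b t'] //=; first by rewrite leqnn.
  case: ltnP => [_|le_ax] _ /=; first by rewrite leqnn row_le_nil.
  by case: row_insert => t1 o /=; rewrite le_ax row_le_nil.
case/andP=> le_ab tt'; have [lt_xb|le_bx] := ltnP x b.
  case: ltnP => [_|le_ax] /=; first by rewrite leqnn.
  by have := row_le_insertl x tt'; case: row_insert => t1 o /= ->; rewrite le_ax.
rewrite ltnNge (leq_trans le_ab le_bx) /=; have := IH _ tt'.
by case: row_insert => t1 o; case: row_insert => t2 o2 /= ->; rewrite le_ab.
Qed.

(** Inserting the smaller letter first gives the smaller row. Consequently an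
    ascent swap cannot lengthen the first row. *)
Lemma row_le_swap x y r : x < y ->
  row_le (first_row_insert r [:: x; y]) (first_row_insert r [:: y; x]).
Proof.
rewrite /first_row_insert /= => lt_xy; elim: r => [|h t IH] /=.
  by rewrite ltnNge (ltnW lt_xy) /= lt_xy /= leqnn.
have [lt_xh|le_hx] := ltnP x h.
  rewrite /= ltnNge (ltnW lt_xy) /=.
  case: ltnP => [lt_yh|le_hy] /=.
    rewrite lt_xy; have := row_le_insertl y (row_le_refl t).
    by case: row_insert => t1 o /= ->; rewrite leqnn.
  by case: row_insert => t1 o /=; rewrite lt_xh /= leqnn row_le_refl.
rewrite (ltnNge y) (leq_trans le_hx (ltnW lt_xy)) /=.
move: IH; case: (row_insert x t) => t1 o1; case: (row_insert y t) => t2 o2 /=.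
rewrite (ltnNge y) (leq_trans le_hx (ltnW lt_xy)) (ltnNge x) le_hx /=.
case: (row_insert y t1) => t3 o3; case: (row_insert x t2) => t4 o4 /= ->.
by rewrite leqnn.
Qed.

Lemma ascent_swap_first_row u w : ascent_swap u w -> first_row_size w <= first_row_size u.
Proof.
case=> A [x [y [B [lt_xy -> ->]]]]; apply: row_le_size.
rewrite /first_row_insert !foldl_cat -/(first_row_insert _ A).
move: (first_row_insert [::] A) => r.
rewrite -!/(first_row_insert _ _).
have := row_le_swap r lt_xy; move: (first_row_insert r _) (first_row_insert r _).
elim/last_ind: B => [|B z IH] r1 r2 // le12.
by rewrite /first_row_insert !foldl_rcons; apply/row_le_insert/IH.
Qed.

Lemma word_le_first_row u w : word_le u w -> first_row_size w <= first_row_size u.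
Proof.
elim=> {u w} [u w [|k]|u|u v w _ uv _ vw] //.
- exact: ascent_swap_first_row.
- by rewrite !first_row_sizeE (knuth_step_tab k).
- exact: leq_trans vw uv.
Qed.

Lemma word_le_perm u w : word_le u w -> perm_eq u w.
Proof.
elim=> {u w} [u w|u|u v w _ uv _ vw] //; last exact: perm_trans uv vw.
case=> [[A [x [y [B [_ -> ->]]]]]|k].
  by rewrite perm_cat2l perm_cat2r (perm_catC [:: x] [:: y]).
by rewrite perm_sym; apply/plactic_perm/rst_step.
Qed.

Lemma knuth_step_rev u w : uniq u -> knuth_step u w -> plactic (rev u) (rev w).
Proof.
move=> un [A [p [q [B [kpq eu ew]]]]]; move: un; rewrite eu ew.
rewrite !rev_cat -!catA !cat_uniq => /and3P[_ _ /andP[un _]]; apply: plactic_cat.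
case: kpq un => x y z h1 h2; rewrite /= !inE => un.
  by apply/plactic_sym/plactic_acb; lia.
by apply/plactic_sym/plactic_bac; lia.
Qed.

(** Reversal turns ascent swaps around and, for distinct letters, preserves Knuth
    equivalence. The first row of the reversed word will play the role of the
    first column. *)
Lemma word_le_first_row_rev u w : uniq u -> word_le u w ->
  first_row_size (rev u) <= first_row_size (rev w).
Proof.
move=> un uw; elim: uw un => {u w} [u w st|u|u v w uv IH1 _ IH2] un //; last first.
  by apply: leq_trans (IH1 un) (IH2 _); rewrite -(perm_uniq (word_le_perm uv)).
case: st => [[A [x [y [B [lt_xy -> ->]]]]]|k].
  by apply: ascent_swap_first_row; exists (rev B), x, y, (rev A); rewrite !rev_cat -!catA.
rewrite !first_row_sizeE; have := plactic_perm (rst_step _ _ _ _ k) => p.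
by rewrite -(perm_uniq p) in un; rewrite (plactic_tab (knuth_step_rev un k)).
Qed.

Lemma decreasing_first_row r s : sorted gtn s ->
  size (first_row_insert r s) <= (size r).+1.
Proof.
case: s => [|x s] //=; rewrite /first_row_insert /= -/(first_row_insert _ s) => p_s.
have hx : x \in (row_insert x r).1.
  by case: row_insertP => *; rewrite ?mem_rcons ?mem_cat inE eqxx ?orbT.
have : size (row_insert x r).1 <= (size r).+1.
  by case: row_insertP => [_|r1 y r2 -> _ _] /=; rewrite ?size_rcons ?size_cat.
move: (row_insert x r).1 hx => r1 hx /(leq_trans _); apply.
elim: s x r1 hx p_s {r} => //= y s IH x r hx /andP[lt_yx p_s].
have hy : y \in (row_insert y r).1.
  by case: row_insertP => *; rewrite ?mem_rcons ?mem_cat inE eqxx ?orbT.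
apply: leq_trans (IH _ _ hy p_s) _.
case: row_insertP => [le_r|r1 v r2 -> _ _] /=; last by rewrite !size_cat.
by have := allP le_r _ hx; rewrite leqNgt lt_yx.
Qed.

(** The reversed reading word consists of the rows, each of them decreasing, and a
    decreasing word lengthens the first row by at most one cell. *)
Lemma rows_ge_first_row_rev w : uniq w ->
  first_row_size (rev w) <= size (tab_word w).
Proof.
move=> un; have le_w := plactic_word_le (plactic_reading_word w).
apply: leq_trans (word_le_first_row_rev un le_w) _ => {le_w}.
have := tab_word_uniq_rows un; rewrite /reading_word; move: (tab_word w) => T {un}.
rewrite rev_flatten -map_rev revK /first_row_size.
have aux r : all (sorted ltn) T ->
    size (first_row_insert r (flatten (map rev T))) <= size r + size T.
  elim: T r => [|t T IH] r /=; first by rewrite addn0.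
  case/andP=> s_t s_T; rewrite /first_row_insert foldl_cat addnS.
  apply: leq_trans (IH _ s_T) _; rewrite -addSn leq_add2r.
  by apply: decreasing_first_row; rewrite rev_sorted.
exact: aux.
Qed.

Lemma row_word_increasing r w : sorted leq (r ++ w) -> row_word r w = (r ++ w, [::]).
Proof.
elim: w r => [|x w IH] r; first by rewrite cats0.
move=> s_rw; have le_r : all (fun e => e <= x) r.
  move: s_rw; rewrite (sorted_pairwise leq_trans) pairwise_cat allrel_consr.
  by case/andP=> /andP[].
rewrite /=; case: row_insertP => [_ | r1 y r2 re _ lt_xy].
  by rewrite IH cat_rcons.
by move: le_r; rewrite re all_cat /= => /and3P[_]; rewrite leqNgt lt_xy.
Qed.

Lemma first_row_insertE r w : first_row_insert r w = (row_word r w).1.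
Proof.
elim: w r => //= x w IH r; rewrite /first_row_insert /= -/(first_row_insert _ w) IH.
by case: row_insert => r1 o /=; case: row_word.
Qed.

Lemma first_row_insert_cat r u w :
  first_row_insert r (u ++ w) = first_row_insert (first_row_insert r u) w.
Proof. exact: foldl_cat. Qed.

Lemma reading_word_hook r c : reading_word (r :: column c) = rev c ++ r.
Proof.
rewrite reading_word_cons /reading_word /column -map_rev; congr cat.
by elim: (rev c) => //= x c' ->.
Qed.

Lemma flatten_column c : flatten (column c) = c.
Proof. by elim: c => //= x c ->. Qed.

Lemma first_row_rev_hook h t c : sorted ltn (h :: t) -> path ltn h c ->
  first_row_size (rev (reading_word ((h :: t) :: column c))) = (size c).+1.
Proof.
move=> s_r p_c; rewrite reading_word_hook rev_cat revK /first_row_size first_row_insert_cat.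
have -> : first_row_insert [::] (rev (h :: t)) = [:: h].
  elim: t h s_r {p_c} => //= x t IH h /andP[lt_hx s_t].
  by rewrite rev_cons -cats1 first_row_insert_cat IH //= /first_row_insert /= lt_hx.
rewrite first_row_insertE row_word_increasing //=.
by apply: sub_path p_c => x y; apply: ltnW.
Qed.

Lemma path_column h t c : path col_increasing (h :: t) (column c) = path ltn h c.
Proof.
elim: c h t => //= x c IH h t; rewrite IH col_increasing_cons.
by rewrite andbT.
Qed.

Variant hook_tableau k : tableau -> Prop :=
| HookTableau h t c of sorted ltn (h :: t) & path ltn h c
    & perm_eq (h :: t ++ c) (iota 1 k) : hook_tableau k ((h :: t) :: column c).

Lemma SYT_hook_tableau k R : R \in SYT k -> is_hook (shape R) -> hook_tableau k R.
Proof.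
case/and4P=> ne_R s_R col_R p_R [a [m [a_gt0 shR]]].
case: R ne_R s_R col_R p_R shR => [|[|h t] T] //= _ /andP[s_t s_T] col_R p_R [_ shT].
have e : T = column (flatten T).
  elim: T m shT {s_T col_R p_R} => [|[|x [|y r]] T IH] [|m] //= [] // shT.
  by rewrite {1}(IH _ shT).
by rewrite e; constructor=> //; rewrite -(path_column h t) -e.
Qed.

(** The letter [i.+1] occurs before [i]. Looking at the subword of these two
    letters makes it plain that swaps involving other letters do not matter. *)
Definition inverted i (v : seq nat) : bool :=
  [seq x <- v | (x == i) || (x == i.+1)] == [:: i.+1; i].

Lemma word_le_inverted i u w : uniq u -> word_le u w -> inverted i u -> inverted i w.
Proof.
move=> un uw; elim: uw un => {u w} [u w st|u|u v w uv IH1 _ IH2] un //; last first.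
  by move/(IH1 un)/IH2; apply; rewrite -(perm_uniq (word_le_perm uv)).
case: st un => [[A [x [y [B [lt_xy -> ->]]]]]|[A [p [q [B [kpq -> ->]]]]]] un.
  rewrite /inverted !filter_cat /=.
  have [hx|] := boolP ((x == i) || (x == i.+1)); last by case: ifP.
  have [hy|] := boolP ((y == i) || (y == i.+1)) => //.
  have [-> ->] : x = i /\ y = i.+1 by lia.
  by case: (filter _ A) => [|a [|b [|c A']]] //= /eqP[] //; lia.
have {}un : uniq q by move: un; rewrite !cat_uniq => /and3P[_ _ /andP[]].
rewrite /inverted !filter_cat.
suff -> : [seq x <- q | (x == i) || (x == i.+1)] =
          [seq x <- p | (x == i) || (x == i.+1)] by [].
case: kpq un => x y z h1 h2; rewrite /= !inE => un.
  have : ~~ (((x == i) || (x == i.+1)) && ((z == i) || (z == i.+1))) by lia.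
  by do 3!case: ifP.
have : ~~ (((x == i) || (x == i.+1)) && ((z == i) || (z == i.+1))) by lia.
by do 3!case: ifP.
Qed.

Lemma filter_pair i s : sorted ltn s ->
  [seq x <- s | (x == i) || (x == i.+1)] = [seq x <- [:: i; i.+1] | x \in s].
Proof.
move=> s_s; apply: (irr_sorted_eq ltn_trans ltnn).
- exact: sorted_filter ltn_trans _ _ s_s.
- by apply: sorted_filter ltn_trans _ _ _; rewrite /= ltnSn.
by move=> x; rewrite !mem_filter !inE andbC.
Qed.

Lemma inverted_hook k h t c i : sorted ltn (h :: t) -> path ltn h c ->
  perm_eq (h :: t ++ c) (iota 1 k) -> 0 < i < k ->
  inverted i (reading_word ((h :: t) :: column c)) = (i.+1 \in c).
Proof.
move=> s_t p_c p_tc hi; rewrite /inverted reading_word_hook filter_cat filter_rev.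
rewrite !filter_pair ?(path_sorted p_c) // /=.
have p_tc' : perm_eq ((h :: t) ++ c) (iota 1 k) := p_tc.
have un : uniq ((h :: t) ++ c) by rewrite (perm_uniq p_tc') iota_uniq.
have mem_tc x : 0 < x <= k -> (x \in h :: t) = ~~ (x \in c).
  move=> hx; have : x \in (h :: t) ++ c by rewrite (perm_mem p_tc') mem_iota; lia.
  rewrite mem_cat; move: un; rewrite cat_uniq => /and3P[_ /hasPn un _].
  by case: (boolP (x \in c)) => [/un /negbTE -> //|_]; rewrite orbF.
rewrite !mem_tc; try lia.
by case: (i \in c); case: (i.+1 \in c); rewrite /= ?eqseq_cons /= ?eqxx ?andbF //; lia.
Qed.

Lemma hook_tableau_eq k R R' : hook_tableau k R -> hook_tableau k R' ->
  (forall i, inverted i (reading_word R) = inverted i (reading_word R')) -> R = R'.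
Proof.
case=> h t c s_t p_c p_tc [h' t' c' s_t' p_c' p_tc'] e.
have mem_c x : x \in c -> 1 < x <= k.
  move=> xc; have : x \in h :: t ++ c by rewrite inE mem_cat xc !orbT.
  have : h \in h :: t ++ c by rewrite mem_head.
  rewrite !(perm_mem p_tc) !mem_iota.
  by have := allP (order_path_min ltn_trans p_c) _ xc; lia.
have mem_c' x : x \in c' -> 1 < x <= k.
  move=> xc; have : x \in h' :: t' ++ c' by rewrite inE mem_cat xc !orbT.
  have : h' \in h' :: t' ++ c' by rewrite mem_head.
  rewrite !(perm_mem p_tc') !mem_iota.
  by have := allP (order_path_min ltn_trans p_c') _ xc; lia.
have ec : c = c'.
  apply: (irr_sorted_eq ltn_trans ltnn); [exact: path_sorted p_c|exact: path_sorted p_c'|].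
  move=> x; have [hx|nx] := boolP (1 < x <= k); last first.
    by apply/idP/idP => [/mem_c|/mem_c']; rewrite (negbTE nx).
  have hx1 : 0 < x.-1 < k by lia.
  have := e x.-1; rewrite (inverted_hook s_t p_c p_tc hx1).
  by rewrite (inverted_hook s_t' p_c' p_tc' hx1) prednK //; lia.
subst c'; congr (_ :: _); apply: (irr_sorted_eq ltn_trans ltnn) => // x.
have : perm_eq (h :: t) (h' :: t').
  by rewrite -(perm_cat2r c) /= (perm_trans p_tc) // perm_sym.
by move/perm_mem ->.
Qed.

(** Counting cells detects a column: this is how a tableau with a long first row
    and many rows is recognised as a hook. *)
Lemma singleton_rows (T : tableau) : all (fun r => r != [::]) T ->
  size T <= size (flatten T) ?= iff (T == column (flatten T)).
Proof.
elim: T => [|r T IH] /=; first by split.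
case/andP=> r0 /IH{IH}; rewrite size_cat => IH.
case: r r0 => [|x [|y r]] //= _.
  move/leqifP: IH => IH; apply/leqifP; move: IH.
  by rewrite /= eqseq_cons eqxx /=; case: eqP => _; lia.
apply/leqifP; rewrite ifN; first by case: IH; lia.
by apply/eqP => -[].
Qed.

(** Along the order the first row does not get longer, the number of rows does not
    drop and inverted pairs remain inverted. The two lengths of a hook with [k] cells sum
    to [k.+1], so [v] inserts to a tableau whose first row and number of rows are
    large enough to make it a hook of the same shape; and a hook tableau is
    determined by its inverted pairs, which are squeezed as well. *)
Lemma hook_squeeze k R v0 v v1 : hook_tableau k R -> perm_eq v0 (iota 1 k) ->
  tab_word v0 = R -> tab_word v1 = R -> word_le v0 v -> word_le v v1 -> tab_word v = R.
Proof.
move=> hR p_v0 e0 e1 le0 le1.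
have p_v : perm_eq v (iota 1 k) by rewrite -(permPl (word_le_perm le0)).
have u_v : uniq v by rewrite (perm_uniq p_v) iota_uniq.
have u_v0 : uniq v0 by rewrite (perm_uniq p_v0) iota_uniq.
have p0 := plactic_reading_word v0; rewrite e0 in p0.
have p1 := plactic_reading_word v1; rewrite e1 in p1.
have pv := plactic_reading_word v.
have le_row : size (nth [::] R 0) <= size (nth [::] (tab_word v) 0).
  by rewrite -e1 -!first_row_sizeE; apply: word_le_first_row.
have le_col : size R <= size (tab_word v).
  apply: leq_trans (rows_ge_first_row_rev u_v).
  apply: leq_trans (word_le_first_row_rev u_v0 le0).
  have := word_le_first_row_rev _ (plactic_word_le (plactic_sym p0)).
  rewrite -(perm_uniq (plactic_perm p0)) => /(_ u_v0); apply: leq_trans.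
  by case: hR => h t c s_t p_c _; rewrite first_row_rev_hook //= size_map.
have hv : hook_tableau k (tab_word v).
  have := tab_word_SYT p_v; have := tab_word_perm v.
  move: le_row le_col; case: (tab_word v) => [|r T].
    by case: hR => h t c _ _ _ /=; rewrite ltn0.
  case: hR => h t c s_t p_c p_tc /= le_row; rewrite ltnS size_map => le_col.
  move=> /perm_size; rewrite size_cat => sz SYT_T.
  have ne_T : all (fun r => r != [::]) T by case/and4P: (SYT_T) => /andP[].
  have {}sz : size r + size (flatten T) = (size t).+1 + size c.
    rewrite sz (perm_size p_v) -(perm_size p_tc) /= size_cat; lia.
  have := singleton_rows ne_T => -[le_T eT].
  have /eqP eTc : T == column (flatten T) by rewrite -eT; apply/eqP; lia.
  apply: SYT_hook_tableau => //; exists (size r), (size (flatten T)).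
  split; first by lia.
  by rewrite /= eTc flatten_column; congr cons; elim: (flatten T) => //= x s ->.
apply: hook_tableau_eq hv hR _ => i.
have inv_eq u w : uniq u -> plactic u w -> inverted i u = inverted i w.
  move=> un p; have un' : uniq w by rewrite -(perm_uniq (plactic_perm p)).
  apply/idP/idP; first exact: (word_le_inverted un (plactic_word_le p)).
  exact: (word_le_inverted un' (plactic_word_le (plactic_sym p))).
have u_v1 : uniq v1 by rewrite -(perm_uniq (word_le_perm le1)).
rewrite -(inv_eq _ _ u_v pv); apply/idP/idP => [iv|].
  by rewrite -(inv_eq _ _ u_v1 p1); apply: word_le_inverted le1 iv.
rewrite -(inv_eq _ _ u_v0 p0) => i0; exact: word_le_inverted le0 i0.
Qed.

(** * Translation of words *)

Lemma hook_tableau_hookish k R : hook_tableau k R -> hookish R.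
Proof. by case=> h t [|x c]. Qed.

Lemma hook_tableau_perm k R v : hook_tableau k R -> tab_word v = R -> perm_eq v (iota 1 k).
Proof.
case=> h t c _ _ p e; apply: perm_trans p; rewrite perm_sym.
by have := tab_word_perm v; rewrite e /= flatten_column.
Qed.

Lemma tab_reading_word_hook k R : hook_tableau k R -> tab_word (reading_word R) = R.
Proof.
case=> h t c s_t p_c _; rewrite reading_word_hook /tab_word foldl_cat.
have -> : foldl tableau_insert [::] (rev c) = column c.
  elim: c {p_c}(path_sorted p_c) => // x c IH p_c.
  by rewrite rev_cons foldl_rcons IH ?column_insert // (path_sorted p_c).
rewrite /= column_insert // foldl_tableau_insert_cons row_word_increasing //.
by apply: sub_sorted s_t => x y; apply: ltnW.
Qed.

Lemma descents_reading_word_hook k R : hook_tableau k R ->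
  descents (reading_word R) = nseq (size R).-1 true ++ nseq (size (head [::] R)).-1 false.
Proof.
case=> h t c s_t p_c _; rewrite reading_word_hook descents_cat /= size_map; congr cat.
  rewrite -rev_cons; elim: c h p_c {s_t} => //= x c IH h /andP[lt_hx p_c].
  rewrite !rev_cons descents_rcons -rev_cons IH // lt_hx -cats1 -(nseqD _ 1) addn1.
  by [].
rewrite /descents; elim: t h s_t {p_c} => //= x t IH h /andP[lt_hx s_t].
by rewrite IH // ltnNge (ltnW lt_hx).
Qed.

(** The positions of the descents tell whether a triple admits a Knuth move and
    what the descents are afterwards, so a Knuth move of [v] can be imitated in
    [v']. *)
Lemma hook_flip_transfer v w v' : uniq v -> uniq v' -> size v = size v' ->
  hookish (tab_word v) -> hookish (tab_word v') -> descents v = descents v' ->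
  knuth_step v w \/ knuth_step w v ->
  exists w', tab_word w' = tab_word v' /\ descents w = descents w'.
Proof.
move=> un un' sz hk hk' de kn.
have [A [p [q [B [kpq ev ew]]]]] : exists A p q B,
    [/\ knuth3 p q \/ knuth3 q p, v = A ++ p ++ B & w = A ++ q ++ B].
  case: kn => [[A [p [q [B [k -> ->]]]]]|[A [p [q [B [k -> ->]]]]]].
    by exists A, p, q, B; split; auto.
  by exists A, q, p, B; split; auto.
have un_p : uniq p by move: un; rewrite ev !cat_uniq => /and3P[_ _ /andP[]].
have [x [y [z [ep eq alt]]]] := knuth3_flip un_p kpq.
have [A' [x' [y' [z' [B' [ev' szA]]]]]] : exists A' x' y' z' B',
    v' = A' ++ [:: x'; y'; z'] ++ B' /\ size A = size A'.
  have lt_A : size A + 3 <= size v' by rewrite -sz ev ep !size_cat /=; lia.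
  exists (take (size A) v'), (nth 0 v' (size A)), (nth 0 v' (size A).+1),
    (nth 0 v' (size A).+2), (drop (size A).+3 v').
  have lt_A1 : (size A).+1 < size v' by lia.
  have lt_A2 : (size A).+2 < size v' by lia.
  have lt_A0 : size A < size v' by lia.
  rewrite size_takel; last exact: ltnW.
  by rewrite /= -!drop_nth // cat_take_drop.
have un3 : uniq [:: x'; y'; z'].
  by move: un'; rewrite ev' !cat_uniq => /and3P[_ _ /andP[]].
move: un_p hk hk' de; rewrite ev ev' ep ew eq => un_p hk hk' de.
have [e1 e2 e3] := descents_flip3_eq un_p un3 szA alt hk hk' de.
exists (A' ++ flip3 x' y' z' ++ B'); split=> //.
by apply: flip3_tab => //; rewrite e1 e2.
Qed.

(** The reading words of two hook tableaux of the same shape have the same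
    descents. Imitating the Knuth moves that lead from the reading word of [R] to
    [v] produces [v']. *)
Lemma hook_word_transfer k R Q v :
  hook_tableau k R -> hook_tableau k Q -> shape R = shape Q -> tab_word v = R ->
  exists v', tab_word v' = Q /\ descents v = descents v'.
Proof.
move=> hR hQ shRQ eR; pose P v := exists v', tab_word v' = Q /\ descents v = descents v'.
have P0 : P (reading_word R).
  exists (reading_word Q); rewrite (tab_reading_word_hook hQ); split=> //.
  rewrite (descents_reading_word_hook hR) (descents_reading_word_hook hQ).
  case: hR shRQ => h t c _ _ _; case: hQ => h' t' c' _ _ _ [/= -> shc].
  by have := congr1 size shc; rewrite !size_map => ->.
have sq v1 : P v1 -> tab_word v1 = R ->
    forall w1, knuth_step v1 w1 \/ knuth_step w1 v1 -> P w1.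
  case=> v' [eQ de] e1 w1 kn.
  have p1 := hook_tableau_perm hR e1; have p' := hook_tableau_perm hQ eQ.
  have un1 : uniq v1 by rewrite (perm_uniq p1) iota_uniq.
  have un' : uniq v' by rewrite (perm_uniq p') iota_uniq.
  have sz : size v1 = size v' by rewrite (perm_size p1) (perm_size p').
  have hk1 : hookish (tab_word v1) by rewrite e1 (hook_tableau_hookish hR).
  have hk' : hookish (tab_word v') by rewrite eQ (hook_tableau_hookish hQ).
  have [w' [ew' dw']] := hook_flip_transfer un1 un' sz hk1 hk' de kn.
  by exists w'; rewrite ew'.
have pl := plactic_sym (plactic_reading_word v); rewrite eR in pl.
have eR0 := tab_reading_word_hook hR.
suff [] : P (reading_word R) <-> P v by move=> h _; apply: h.
elim: pl eR0 {eR} => {v} [u w kn|u|u w uw IH|u v w uv IH1 _ IH2] eu.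
- have ew : tab_word w = R by rewrite -(knuth_step_tab kn).
  by split=> [pu|pw]; [apply: (sq u)|apply: (sq w)]; auto.
- by [].
- by apply: iff_sym; apply: IH; rewrite (plactic_tab uw).
- by apply: (iff_trans (IH1 eu)); apply: IH2; rewrite -(plactic_tab uv).
Qed.

(** The lift of [inner_translation R Q] to words: for hooks of the same
    shape, equal descents make the two recording tableaux of the small letters
    coincide. *)
Definition translated k R Q (u u' : seq nat) : Prop :=
  [/\ outer_letters k u = outer_letters k u', tab_word (low k u) = R,
      tab_word (low k u') = Q & descents (low k u) = descents (low k u')].

Lemma translated_sym k R Q u u' : translated k R Q u u' -> translated k Q R u' u.
Proof. by case. Qed.

Lemma outer_letters_cat k u w :
  outer_letters k (u ++ w) = outer_letters k u ++ outer_letters k w.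
Proof. exact: map_cat. Qed.

Lemma low_consE k x B : low k (x :: B) = if x <= k then x :: low k B else low k B.
Proof. by []. Qed.

Lemma outer_letters_consE k x B :
  outer_letters k (x :: B) = (if x <= k then 0 else x) :: outer_letters k B.
Proof. by []. Qed.

Lemma outer_letters_split k A B u : outer_letters k (A ++ B) = outer_letters k u ->
  exists A' B', [/\ u = A' ++ B', outer_letters k A = outer_letters k A'
    & outer_letters k B = outer_letters k B'].
Proof.
move=> e; have szA : size A <= size u.
  by move: (congr1 size e); rewrite !size_map size_cat; lia.
move/eqP: e; rewrite -{1}(cat_take_drop (size A) u) !outer_letters_cat.
rewrite eqseq_cat; last by rewrite !size_map size_takel.
case/andP=> /eqP eA /eqP eB; exists (take (size A) u), (drop (size A) u).
by rewrite cat_take_drop.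
Qed.

Lemma outer_letters_cons k x B u : outer_letters k (x :: B) = outer_letters k u ->
  exists x' B', [/\ u = x' :: B', (x' <= k) = (x <= k), k < x -> x' = x
    & outer_letters k B = outer_letters k B'].
Proof.
case: u => [|x' B'] //= -[ex eB]; exists x', B'.
by move: ex; case: (leqP x k) => hx; case: (leqP x' k) => hx' ex; split=> //; lia.
Qed.

Lemma outer_letters_high k B B' : all (ltn k) B ->
  outer_letters k B = outer_letters k B' -> B' = B.
Proof.
elim: B B' => [|x B IH] B'; first by case: B'.
move=> /= /andP[lt_kx hB] /outer_letters_cons[x' [B1 [-> _ /(_ lt_kx) -> /IH ->]]] //.
Qed.

Lemma all_high_low k B : all (ltn k) B -> low k B = [::].
Proof.
elim: B => //= x B IH /andP[lt_kx /IH ->]; by rewrite leqNgt lt_kx.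
Qed.

Lemma low_split k B s b : low k B = s :: b ->
  exists B1 B2, [/\ B = B1 ++ s :: B2, all (ltn k) B1, low k B2 = b & s <= k].
Proof.
elim: B => //= x B IH; case: (leqP x k) => [le_xk [<- <-]|lt_kx /IH].
  by exists [::], B.
by case=> B1 [B2 [-> h1 h2 h3]]; exists (x :: B1), B2; rewrite /= lt_kx.
Qed.

Lemma low_rsplit k A t a : low k A = rcons a t ->
  exists A1 A2, [/\ A = A1 ++ t :: A2, all (ltn k) A2, low k A1 = a & t <= k].
Proof.
elim/last_ind: A => [|A x IH]; first by case: a.
rewrite low_rcons; case: (leqP x k) => [le_xk /rcons_inj[<- <-]|lt_kx /IH].
  by exists A, [::]; rewrite cats1.
case=> A1 [A2 [-> h1 h2 h3]]; exists A1, (rcons A2 x).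
by rewrite rcons_cat /= all_rcons /= lt_kx.
Qed.

Lemma translated_inner k R Q u u' : hookish R -> hookish Q ->
  translated k R Q u u' -> inner_translation R Q (tab_word u) = tab_word u'.
Proof.
move=> hR hQ [eo eR eQ de]; rewrite -eR -eQ; apply: inner_translation_tab_word.
apply: tab_word_same_outer => // p s p' s' ep ep' sz.
by apply: (@shape_hook_prefix p s p' s') => //; rewrite -?ep -?ep' ?eR ?eQ.
Qed.

Lemma translated_perm n k R Q u u' : hook_tableau k R -> hook_tableau k Q ->
  translated k R Q u u' -> perm_eq u (iota 1 n) -> perm_eq u' (iota 1 n).
Proof.
move=> hR hQ [eo eR eQ _]; apply: perm_trans.
have high_outer w : high k w = [seq x <- outer_letters k w | k < x].
  by elim: w => //= x w ->; case: (leqP x k) => h; decide_comparisons.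
have eh : high k u = high k u' by rewrite !high_outer eo.
have pf w : perm_eq w (low k w ++ high k w).
  have -> : high k w = [seq x <- w | predC (leq^~ k) x].
    by apply: eq_filter => x; rewrite /= ltnNge.
  by rewrite perm_sym; apply: permEl (perm_filterC (leq^~ k) w).
rewrite perm_sym; apply: perm_trans (pf u) _; rewrite eh perm_sym.
apply: perm_trans (pf u') _; rewrite perm_cat2r.
apply: perm_trans (hook_tableau_perm hQ eQ) _; rewrite perm_sym.
exact: hook_tableau_perm hR eR.
Qed.

Fixpoint fill_low k (u s : seq nat) : seq nat :=
  if u is x :: u' then
    if x <= k then head 0 s :: fill_low k u' (behead s) else x :: fill_low k u' s
  else [::].

Lemma fill_lowP k u s : all (fun x => x <= k) s -> size s = size (low k u) ->
  low k (fill_low k u s) = s /\ outer_letters k u = outer_letters k (fill_low k u s).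
Proof.
elim: u s => [|x u IH] s /=; first by case: s.
case: (leqP x k) => [le_xk|lt_kx] /=; last first.
  by move=> h1 h2; have [-> <-] := IH s h1 h2; rewrite leqNgt lt_kx.
case: s => //= y s /andP[le_yk hs] [sz]; have [-> <-] := IH s hs sz.
by rewrite le_yk.
Qed.

Lemma translated_exists k R Q u : hook_tableau k R -> hook_tableau k Q ->
  shape R = shape Q -> tab_word (low k u) = R -> exists u', translated k R Q u u'.
Proof.
move=> hR hQ shRQ eR; have [v' [eQ de]] := hook_word_transfer hR hQ shRQ eR.
have pR := hook_tableau_perm hR eR; have pQ := hook_tableau_perm hQ eQ.
have hv' : all (fun x => x <= k) v'.
  by apply/allP => x; rewrite (perm_mem pQ) mem_iota; lia.
have [|e1 e2] := @fill_lowP k u v' hv'; first by rewrite (perm_size pR) (perm_size pQ).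
by exists (fill_low k u v'); split; rewrite ?e1.
Qed.

(** The swap turns an ascent into a descent, and both words have as many descents
    as the column has cells, so a descent at one of the two neighbours must
    disappear. The letter at this neighbour lies between [x] and [y]. *)
Lemma hook_swap_witness a b x y : x < y -> uniq (a ++ [:: x, y & b]) ->
  hookish (tab_word (a ++ [:: x, y & b])) ->
  tab_word (a ++ [:: x, y & b]) = tab_word (a ++ [:: y, x & b]) ->
  (exists s b0, b = s :: b0 /\ x < s < y) \/ (exists t a0, a = rcons a0 t /\ x < t < y).
Proof.
move=> lt_xy un hk /(count_descents_hook hk).
rewrite !descents_cat /= [descents (x :: y :: b)](_ : _ = (y < x) :: descents (y :: b)) //.
rewrite [descents (y :: x :: b)](_ : _ = (x < y) :: descents (x :: b)) //.
rewrite !count_cat /= lt_xy ltnNge (ltnW lt_xy) /=.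
have dE p q B : descents (p :: q :: B) = (q < p) :: descents (q :: B) by [].
have un_a a0 t : a = rcons a0 t -> t != x /\ t != y.
  move=> ea; move: un; rewrite ea cat_uniq => /and3P[_ /hasPn un _].
  split; apply/eqP => et; have := un t.
    by rewrite !inE et eqxx ?orbT mem_rcons mem_head => /(_ isT).
  by rewrite !inE et eqxx ?orbT mem_rcons mem_head => /(_ isT).
have un_b s b0 : b = s :: b0 -> s != x /\ s != y.
  move=> eb; move: un; rewrite eb cat_uniq /= !inE => /and3P[_ _]; lia.
case/lastP: a un_a {un hk} => [|a t] un_a.
  case: b un_b => [|s b] un_b; first by rewrite /descents /=; lia.
  have := un_b _ _ erefl.
  by rewrite !dE /= => -[ne1 ne2] e; left; exists s, b; split=> //; lia.
rewrite !descents_rcons -!cats1 !count_cat /= !cats1.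
have [ne1 ne2] := un_a _ _ erefl; case: b un_b => [|s b] un_b.
  by rewrite /descents /= => e; right; exists t, a; split=> //; lia.
have [ne3 ne4] := un_b _ _ erefl.
rewrite !dE /= => e; have [lt|ge] := boolP (x < s < y); first by left; exists s, b.
by right; exists t, a; split=> //; lia.
Qed.

Lemma uniq_middle (a p b : seq nat) : uniq (a ++ p ++ b) -> uniq p.
Proof. by rewrite !cat_uniq => /and3P[_ _ /andP[]]. Qed.

(** The letters in corresponding positions need not compare in the same way in
    [u] and in [u']: only neighbours in the subword of small letters do. The
    Knuth partners of the two triples may therefore exchange different pairs of
    positions, and in that case the swap is replaced with one across the block
    [C] of large letters. *)
Lemma translated_ascent k R Q u w u' : hook_tableau k R -> hook_tableau k Q ->
  uniq u -> uniq u' -> ascent_swap u w -> translated k R Q u u' ->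
  tab_word (low k w) = R -> exists w', translated k R Q w w' /\ word_le u' w'.
Proof.
move=> hR hQ un un' [A [x [y [B [lt_xy eu ew]]]]]; rewrite {}eu {}ew in un *.
case=> eo eR eQ de ewR.
have [A' [B' [eu' eA]]] := outer_letters_split eo.
case/outer_letters_cons => x' [B1 [eB' lx hx]].
case/outer_letters_cons => y' [B2 [eB1 ly hy eB]]; subst B' B1.
rewrite {}eu' in un' eo eQ de *.
have [le_yk|lt_ky] := leqP y k; last first.
  rewrite (hy lt_ky) in eo eQ de ly un' *.
  have lt_x'y : x' < y.
    by case: (leqP x k) lx hx => [_ lx _|lt_kx _ ->] //; apply: leq_ltn_trans lx lt_ky.
  exists (A' ++ [:: y; x'] ++ B2); split; last exact: word_le_swap.
  move: eR eQ de ewR; have hyk : (y <= k) = false by rewrite leqNgt lt_ky.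
  rewrite /translated !low_cat !outer_letters_cat !outer_letters_consE eA eB /= hyk lx.
  case: (leqP x k) hx {lx} => [_ _|_ /(_ isT) ->] eR eQ de ewR; split=> //.
have le_xk : x <= k by lia.
rewrite le_xk in lx; rewrite le_yk in ly; move: {hx hy} eR eQ de ewR.
rewrite !low_cat /= le_xk le_yk lx ly => eR eQ de ewR.
have un_low : uniq (low k (A ++ [:: x; y] ++ B)) by apply: filter_uniq.
have un_low' : uniq (low k (A' ++ [:: x'; y'] ++ B2)) by apply: filter_uniq.
move: un_low un_low'; rewrite !low_cat /= le_xk le_yk lx ly => un_low un_low'.
have szA : size (low k A) = size (low k A') by rewrite !size_low eA.
have hkR : hookish R := hook_tableau_hookish hR.
have hkQ : hookish Q := hook_tableau_hookish hQ.
have hk : hookish (tab_word (low k A ++ [:: x, y & low k B])) by rewrite eR.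
have hk' : hookish (tab_word (low k A' ++ [:: x', y' & low k B2])) by rewrite eQ.
have [|[s [b0 [eb /andP[lt_xs lt_sy]]]]|[t [a0 [ea /andP[lt_xt lt_ty]]]]] :=
  hook_swap_witness lt_xy un_low hk; first by rewrite eR ewR.
(* The witness follows the swapped letters. *)
- have [C [D [eBC hC eD le_sk]]] := low_split eb.
  move: eB; rewrite eBC => /outer_letters_split[C' [D1 [eB2 eC]]].
  case/outer_letters_cons => s' [D' [eD1 ls _ eDD]]; rewrite le_sk in ls.
  rewrite {}eD1 (outer_letters_high hC eC) in eB2.
  move: un_low un_low' eR eQ de ewR hk hk'.
  rewrite eb eB2 !low_cat /= ls (all_high_low hC) /=.
  move=> un_low un_low' eR eQ de ewR hk hk'.
  have un3 : uniq [:: x; y; s] := @uniq_middle _ [:: x; y; s] _ un_low.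
  have un3' : uniq [:: x'; y'; s'] := @uniq_middle _ [:: x'; y'; s'] _ un_low'.
  have alt : (y < x) != (s < y) by rewrite lt_sy ltnNge (ltnW lt_xy).
  have [e1 e2 e3] := descents_flip3_eq un3 un3' szA alt hk hk' de.
  have lt_xy' : x' < y' by move: e1 un3'; rewrite /= !inE; lia.
  have lt_sy' : s' < y' by rewrite e2.
  have fl : flip3 x y s = [:: y; x; s] by rewrite /flip3 lt_xs ltnNge (ltnW lt_xy).
  have eQ' : tab_word (low k A' ++ flip3 x' y' s' ++ low k D') = Q.
    by rewrite flip3_tab ?e1 ?e2.
  have [lt_xs'|le_sx'] := ltnP x' s'.
    have fl' : flip3 x' y' s' = [:: y'; x'; s'].
      by rewrite /flip3 lt_xs' e1 ltnNge (ltnW lt_xy).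
    exists (A' ++ [:: y', x' & C ++ s' :: D']); split; last exact: word_le_swap.
    move: e3 eQ'; rewrite fl fl' => e3 eQ'; split.
    - rewrite !(outer_letters_cat, outer_letters_consE) eA eDD.
      by rewrite le_xk le_yk le_sk lx ly ls.
    - by rewrite !(low_cat, low_consE) le_xk le_yk le_sk (all_high_low hC) /= eD.
    - by rewrite !(low_cat, low_consE) lx ly ls (all_high_low hC) /=.
    - rewrite !(low_cat, low_consE) le_xk le_yk lx ly le_sk ls (all_high_low hC) /=.
      by rewrite eD.
  have lt_sx' : s' < x' by move: un3'; rewrite /= !inE; lia.
  have fl' : flip3 x' y' s' = [:: x'; s'; y'].
    by rewrite /flip3 e1 !ltnNge (ltnW lt_xy) le_sx'.
  exists (A' ++ [:: x', s' & C ++ y' :: D']); split; last first.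
    have hC' : all (ltn y') C by apply: sub_all hC => z; apply: leq_ltn_trans; rewrite ly.
    have := word_le_cat A' D' (word_le_far_descent lt_sx' lt_xy' hC').
    by rewrite /= -!catA.
  move: e3 eQ'; rewrite fl fl' => e3 eQ'; split.
  - rewrite !(outer_letters_cat, outer_letters_consE) eA eDD.
    by rewrite le_xk le_yk le_sk lx ly ls.
  - by rewrite !(low_cat, low_consE) le_xk le_yk le_sk (all_high_low hC) /= eD.
  - by rewrite !(low_cat, low_consE) lx ls ly (all_high_low hC) /=.
  - rewrite !(low_cat, low_consE) le_xk le_yk lx ls le_sk ly (all_high_low hC) /=.
    by rewrite eD.
(* The witness precedes the swapped letters. *)
- have [D [C [eAC hC eD le_tk]]] := low_rsplit ea.
  move: eA; rewrite eAC => /esym /esym /outer_letters_split[D' [C1 [eA' eDD]]].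
  case/outer_letters_cons => t' [C' [eC1 lt _ eC]]; rewrite le_tk in lt.
  rewrite {}eC1 (outer_letters_high hC eC) in eA'.
  move: un_low un_low' eR eQ de ewR hk hk'.
  rewrite ea eA' !(low_cat, low_consE) lt (all_high_low hC) !cat_rcons -!catA /=.
  move=> un_low un_low' eR eQ de ewR hk hk'.
  have un3 : uniq [:: t; x; y] := @uniq_middle _ [:: t; x; y] _ un_low.
  have un3' : uniq [:: t'; x'; y'] := @uniq_middle _ [:: t'; x'; y'] _ un_low'.
  have alt : (x < t) != (y < x) by rewrite lt_xt ltnNge (ltnW lt_xy).
  have szD : size a0 = size (low k D') by rewrite -eD !size_low eDD.
  have [e1 e2 e3] := descents_flip3_eq un3 un3' szD alt hk hk' de.
  have lt_xy' : x' < y' by move: e2 un3'; rewrite /= !inE; lia.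
  have lt_xt' : x' < t' by rewrite e1.
  have fl : flip3 t x y = [:: t; y; x] by rewrite /flip3 lt_ty lt_xt.
  have eQ' : tab_word (low k D' ++ flip3 t' x' y' ++ low k B2) = Q.
    by rewrite flip3_tab ?e1 ?e2.
  have [lt_ty'|le_yt'] := ltnP t' y'.
    have fl' : flip3 t' x' y' = [:: t'; y'; x'] by rewrite /flip3 lt_ty' e1 lt_xt.
    exists (D' ++ t' :: C ++ [:: y', x' & B2]); split; last first.
      by have := word_le_swap (D' ++ t' :: C) B2 lt_xy'; rewrite -!catA.
    move: e3 eQ'; rewrite fl fl' => e3 eQ'; split.
    - rewrite !(outer_letters_cat, outer_letters_consE) eDD eB.
      by rewrite le_xk le_yk le_tk lx ly lt.
    - by rewrite !(low_cat, low_consE) le_xk le_yk le_tk (all_high_low hC) /= eD.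
    - by rewrite !(low_cat, low_consE) lt lx ly (all_high_low hC) /=.
    - by rewrite !(low_cat, low_consE) le_xk le_yk le_tk lx ly lt (all_high_low hC) /= eD.
  have lt_yt' : y' < t' by move: un3'; rewrite /= !inE; lia.
  have fl' : flip3 t' x' y' = [:: x'; t'; y'] by rewrite /flip3 e1 lt_xt ltnNge le_yt'.
  exists (D' ++ x' :: C ++ [:: t', y' & B2]); split; last first.
    have hC' : all (ltn t') C by apply: sub_all hC => z; apply: leq_ltn_trans; rewrite lt.
    have := word_le_cat D' B2 (word_le_far_ascent lt_xy' lt_yt' hC').
    by rewrite /= -!catA.
  move: e3 eQ'; rewrite fl fl' => e3 eQ'; split.
  - rewrite !(outer_letters_cat, outer_letters_consE) eDD eB.
    by rewrite le_xk le_yk le_tk lx ly lt.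
  - by rewrite !(low_cat, low_consE) le_xk le_yk le_tk (all_high_low hC) /= eD.
  - by rewrite !(low_cat, low_consE) lx lt ly (all_high_low hC) /=.
  - by rewrite !(low_cat, low_consE) le_xk le_yk le_tk lx lt ly (all_high_low hC) /= eD.
Qed.

Lemma word_le_low k u w : word_le u w -> word_le (low k u) (low k w).
Proof.
elim=> {u w} [u w st|u|u v w _ uv _ vw]; last exact: word_le_trans uv vw.
  case: st => [[A [x [y [B [lt_xy -> ->]]]]]|[A [p [q [B [kpq -> ->]]]]]].
    rewrite !low_cat /=; have [le_yk|lt_ky] := leqP y k; last first.
      by case: leqP => _; apply: word_le_refl.
    by rewrite (leq_trans (ltnW lt_xy) le_yk); apply: word_le_swap.
  rewrite !low_cat; apply/word_le_cat/plactic_word_le/plactic_sym.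
  case: kpq => x y z h1 h2 /=.
    case: (leqP x k); case: (leqP y k); case: (leqP z k) => * //=;
      first [exact: plactic_refl|exact: plactic_bac|exfalso; lia].
  case: (leqP x k); case: (leqP y k); case: (leqP z k) => * //=;
    first [exact: plactic_refl|exact: plactic_acb|exfalso; lia].
exact: word_le_refl.
Qed.

(** Every word on the way from [u] to [w] has inner tableau [R], so the path can be
    translated step by step. A Knuth step does not change the insertion tableau,
    and any translation of its target will do. *)
Lemma translated_word_le n k R Q u w u' : hook_tableau k R -> hook_tableau k Q ->
  shape R = shape Q -> perm_eq u (iota 1 n) -> word_le u w ->
  translated k R Q u u' -> tab_word (low k w) = R ->
  exists w', translated k R Q w w' /\ word_le u' w'.
Proof.
move=> hR hQ shRQ pu0 /(@clos_rt_rt1n _ _ _ _) uw; move: pu0.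
elim: uw u' => {u w} [u|u v w st vw IH] u' pu tr ew.
  by exists u'; split=> //; apply: word_le_refl.
have {}vw : word_le v w by apply: clos_rt1n_rt.
have uv : word_le u v by apply: rt_step.
have [eo eR eQ de] := tr.
have ev : tab_word (low k v) = R.
  by apply: (hook_squeeze hR (hook_tableau_perm hR eR) eR ew); apply: word_le_low.
have pv : perm_eq v (iota 1 n) by rewrite -(permPl (word_le_perm uv)).
have pu' := translated_perm hR hQ tr pu.
have [v' [trv uv']] : exists v', translated k R Q v v' /\ word_le u' v'.
  case: st => [asc|kn].
    apply: translated_ascent hR hQ _ _ asc tr ev.
      by rewrite (perm_uniq pu) iota_uniq.
    by rewrite (perm_uniq pu') iota_uniq.
  have [v' trv] := translated_exists hR hQ shRQ ev.
  exists v'; split=> //; apply/plactic_word_le/tab_word_plactic.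
  have hkR := hook_tableau_hookish hR; have hkQ := hook_tableau_hookish hQ.
  rewrite -(translated_inner hkR hkQ tr) -(translated_inner hkR hkQ trv).
  by rewrite (knuth_step_tab kn).
have [w' [trw vw']] := IH v' pv trv ew.
by exists w'; split=> //; apply: word_le_trans uv' vw'.
Qed.

(** * Permutations and words *)

Lemma size_one_line n (s : 'S_n) : size (one_line s) = n.
Proof. by rewrite size_map size_enum_ord. Qed.

Lemma nth_one_line n (s : 'S_n) (i : 'I_n) : nth 0 (one_line s) i = (s i).+1.
Proof. by rewrite (nth_map i) ?size_enum_ord // nth_ord_enum. Qed.

Lemma one_line_perm n (s : 'S_n) : perm_eq (one_line s) (iota 1 n).
Proof.
apply: uniq_perm; rewrite ?iota_uniq //.
  by rewrite map_inj_uniq ?enum_uniq // => i j [] /val_inj /perm_inj.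
move=> x; rewrite mem_iota; apply/mapP/idP => [[i _ ->]|hx].
  by have := ltn_ord (s i); lia.
have lt_x : x.-1 < n by lia.
exists ((s^-1)%g (Ordinal lt_x)); first by rewrite mem_enum.
by rewrite permKV /= prednK; lia.
Qed.

Lemma one_line_exists n u : perm_eq u (iota 1 n) -> exists s : 'S_n, one_line s = u.
Proof.
move=> pu; have szu : size u = n by rewrite (perm_size pu) size_iota.
have un : uniq u by rewrite (perm_uniq pu) iota_uniq.
have hu (i : 'I_n) : 0 < nth 0 u i <= n.
  have : nth 0 u i \in u by rewrite mem_nth ?szu.
  by rewrite (perm_mem pu) mem_iota; lia.
have lt_u (i : 'I_n) : (nth 0 u i).-1 < n by have := hu i; lia.
pose f (i : 'I_n) := Ordinal (lt_u i).
have f_inj : injective f.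
  move=> i j [] e; apply/val_inj/eqP; rewrite /= -(nth_uniq 0 _ _ un) ?szu //.
  move: (hu i) (hu j) e; rewrite /f /=.
  move: (nth 0 u i) (nth 0 u j) => a b ha hb e; apply/eqP; move: e; clear -ha hb; lia.
exists (perm f_inj); apply: (@eq_from_nth _ 0); rewrite size_one_line ?szu //.
move=> i lt_i; rewrite (nth_one_line _ (Ordinal lt_i)) permE /= prednK //.
by case/andP: (hu (Ordinal lt_i)).
Qed.

Lemma weak_perm_step_ascent n (s t : 'S_n) :
  weak_perm_step s t -> ascent_swap (one_line s) (one_line t).
Proof.
case/existsP=> i /existsP[j /and3P[/eqP ej lt_ij /eqP ->]].
have lt_j : i.+1 < n by rewrite -ej.
exists (take i (one_line s)), (s i).+1, (s j).+1, (drop i.+2 (one_line s)); split=> //.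
  rewrite -!nth_one_line /= ej -!drop_nth ?size_one_line // cat_take_drop //.
apply: (@eq_from_nth _ 0).
  rewrite !size_cat /= size_takel ?size_drop !size_one_line; lia.
move=> l; rewrite size_one_line => lt_l.
rewrite -[l]/(nat_of_ord (Ordinal lt_l)); move: (Ordinal lt_l) => {lt_l}l.
rewrite nth_one_line permM nth_cat size_takel; last by rewrite size_one_line ltnW.
have [eli|ne_li] := eqVneq l i; first by rewrite eli ltnn subnn tpermL.
have [elj|ne_lj] := eqVneq l j.
  by rewrite elj tpermR ej ltnNge leqnSn subSnn.
rewrite tpermD 1?eq_sym //.
have {}ne_li : (l : nat) != i by apply: contra_neq ne_li => e; apply: val_inj.
have {}ne_lj : (l : nat) != i.+1 by rewrite -ej; apply: contra_neq ne_lj => e; apply: val_inj.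
have [lt_li|le_il] := ltnP l i; first by rewrite nth_take // nth_one_line.
have -> : l - i = (l - i.+2).+2 by lia.
by rewrite /= nth_drop subnKC ?nth_one_line //; lia.
Qed.

Lemma ascent_weak_perm_step n (s t : 'S_n) :
  ascent_swap (one_line s) (one_line t) -> weak_perm_step s t.
Proof.
case=> A [x [y [B [lt_xy es et]]]].
have sz : size A + 2 + size B = n by rewrite -(size_one_line s) es !size_cat /=; lia.
have lt_i : size A < n by lia.
have lt_j : (size A).+1 < n by lia.
have nlt : ((size A).+1 < size A) = false by rewrite ltnNge leqnSn.
have nth_s (l : 'I_n) : (s l).+1 = nth 0 (A ++ [:: x; y] ++ B) l by rewrite -es nth_one_line.
have nth_t (l : 'I_n) : (t l).+1 = nth 0 (A ++ [:: y; x] ++ B) l by rewrite -et nth_one_line.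
apply/existsP; exists (Ordinal lt_i); apply/existsP; exists (Ordinal lt_j).
rewrite eqxx /=; apply/andP; split.
  by rewrite -ltnS !nth_s !nth_cat /= ltnn subnn nlt subSnn.
apply/eqP/permP => l; rewrite permM; apply/val_inj/succn_inj; rewrite nth_s nth_t.
have [->|ne_li] := eqVneq l (Ordinal lt_i).
  by rewrite tpermL !nth_cat /= ltnn subnn nlt subSnn.
have [->|ne_lj] := eqVneq l (Ordinal lt_j).
  by rewrite tpermR !nth_cat /= ltnn subnn nlt subSnn.
rewrite tpermD 1?eq_sym // !nth_cat; case: ltnP => // le_l.
have : (l : nat) != size A by apply: contra_neq ne_li => e; apply: val_inj.
have : (l : nat) != (size A).+1 by apply: contra_neq ne_lj => e; apply: val_inj.
move=> h1 h2; have -> : l - size A = (l - (size A).+2).+2 by lia.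
by [].
Qed.

Lemma weak_perm_word_le n (s t : 'S_n) :
  weak_perm s t -> word_le (one_line s) (one_line t).
Proof.
case/connectP=> p; elim: p s => [|v p IH] s /= => [_ ->|]; first exact: word_le_refl.
case/andP=> /weak_perm_step_ascent st p_p et.
by apply: word_le_trans (IH _ p_p et); apply: rt_step; left.
Qed.

Lemma weak_le_words n S T : weak_le n S T -> exists u w,
  [/\ perm_eq u (iota 1 n), tab_word u = S, tab_word w = T & word_le u w].
Proof.
elim=> {S T} [S T [_ _ [s [t [hs ht st]]]]|S P T _ [u [v [pu eu ev uv]]] _ IH].
  exists (one_line s), (one_line t); split; first exact: one_line_perm.
  - by move: hs; rewrite /Knuth_class in_set => /eqP.
  - by move: ht; rewrite /Knuth_class in_set => /eqP.
  - exact: weak_perm_word_le.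
have [v' [w [_ ev' ew vw]]] := IH.
exists u, w; split=> //; apply: word_le_trans uv (word_le_trans _ vw).
by apply/plactic_word_le/tab_word_plactic; rewrite ev.
Qed.

Lemma words_weak_le n u w : perm_eq u (iota 1 n) -> word_le u w ->
  weak_le n (tab_word u) (tab_word w).
Proof.
have weak_le_of (s t : 'S_n) : weak_perm s t ->
    weak_le n (tab_word (one_line s)) (tab_word (one_line t)).
  move=> st; apply: t_step; split; try exact/tab_word_SYT/one_line_perm.
  by exists s, t; split=> //; rewrite /Knuth_class in_set; apply/eqP.
move=> pu uw; elim: uw pu => {u w} [u w st|u|u v w uv IH1 _ IH2] pu.
- have pw : perm_eq w (iota 1 n) by rewrite -(permPl (word_le_perm (rt_step _ _ _ _ st))).
  have [s es] := one_line_exists pu; have [t et] := one_line_exists pw.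
  case: st => [asc|/knuth_step_tab ->]; last by rewrite -es; apply/weak_le_of/connect0.
  by rewrite -es -et in asc *; apply/weak_le_of/connect1/ascent_weak_perm_step.
- by have [s <-] := one_line_exists pu; apply/weak_le_of/connect0.
- apply: t_trans (IH1 pu) (IH2 _); by rewrite -(permPl (word_le_perm uv)).
Qed.

(** * The translation is an order isomorphism *)

Lemma SYT_inner_tab_word n k R u : perm_eq u (iota 1 n) ->
  (tab_word u \in SYT_inner n k R) = (tab_word (low k u) == R).
Proof. by move=> pu; rewrite unfold_in /SYT_inner tab_word_SYT // inner_tableau_tab_word. Qed.

Lemma inner_translation_le n k R Q S T : hook_tableau k R -> hook_tableau k Q ->
  shape R = shape Q -> S \in SYT_inner n k R -> T \in SYT_inner n k R ->
  weak_le n S T ->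
  [/\ inner_translation R Q S \in SYT_inner n k Q,
      inner_translation R Q T \in SYT_inner n k Q,
      inner_translation Q R (inner_translation R Q S) = S,
      inner_translation Q R (inner_translation R Q T) = T
    & weak_le n (inner_translation R Q S) (inner_translation R Q T)].
Proof.
move=> hR hQ shRQ hS hT /weak_le_words[u [w [pu eS eT uw]]]; subst S T; move: hS hT.
have pw : perm_eq w (iota 1 n) by rewrite -(permPl (word_le_perm uw)).
rewrite !SYT_inner_tab_word // => /eqP eu /eqP ew.
have [u' tru] := translated_exists hR hQ shRQ eu.
have [w' [trw uw']] := translated_word_le hR hQ shRQ pu uw tru ew.
have hkR := hook_tableau_hookish hR; have hkQ := hook_tableau_hookish hQ.
have pu' := translated_perm hR hQ tru pu; have pw' := translated_perm hR hQ trw pw.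
rewrite !(translated_inner hkR hkQ tru) !(translated_inner hkR hkQ trw).
rewrite !(translated_inner hkQ hkR (translated_sym tru)).
rewrite !(translated_inner hkQ hkR (translated_sym trw)).
rewrite !SYT_inner_tab_word //.
by case: tru trw => _ _ -> _ [_ _ -> _]; split=> //; apply: words_weak_le.
Qed.

Theorem proposition4p7 (n k : nat) (R Q S T : tableau)
  (hk : 1 <= k < n)
  (hR : R \in SYT k) (hook_R : is_hook (shape R))
  (hQ : Q \in SYT k) (shape_Q : shape Q = shape R)
  (hS : S \in SYT_inner n k R) (hT : T \in SYT_inner n k R)
  (cov : covering (SYT_inner n k R) (weak_le n) S T) :
  covering (SYT_inner n k Q) (weak_le n)
    (inner_translation R Q S) (inner_translation R Q T).
Proof.
have htR := SYT_hook_tableau hR hook_R.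
have htQ : hook_tableau k Q by apply: SYT_hook_tableau; rewrite ?shape_Q.
case: cov => _ _ le_ST ne_ST no_mid.
have [S'Q T'Q SK TK le_ST'] := inner_translation_le htR htQ (esym shape_Q) hS hT le_ST.
split=> //; first by move=> e; apply: ne_ST; rewrite -SK e TK.
case=> P [PQ ne_PS ne_PT le_SP le_PT]; apply: no_mid.
have [_ P'R _ PK le_SP'] := inner_translation_le htQ htR shape_Q S'Q PQ le_SP.
have [_ _ _ _ le_PT'] := inner_translation_le htQ htR shape_Q PQ T'Q le_PT.
rewrite SK in le_SP'; rewrite TK in le_PT'.
exists (inner_translation Q R P); split=> //.
  by move=> e; apply: ne_PS; rewrite -PK e.
by move=> e; apply: ne_PT; rewrite -PK e.
Qed.
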